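(* Suppose Assumptions 2, 3, 4 and 5 (stated in the context) hold and let $\{\boldsymbol{x}_{i,t},\boldsymbol{y}_{i,t}\}$, $i\in[n]$, be the decision sequence obtained from Algorithm Multi-DOSMD-CCO (described in the context). Then, for $T\ge2$ and $j\in\mathcal V$, $$\textbf{ESP-Regret}_d^j(T)\le I_1+\frac{\Gamma_1\sigma_1^{\underline K-1}}{1-\sigma_1^{\underline K}}I_2+\Big(I_3+\frac{\Gamma_1\sigma_1^{\underline K-1}}{1-\sigma_1^{\underline K}}I_4\Big)\sum_{t=1}^T\alpha_t+\Big(I_5+\frac{\Gamma_1\sigma_1^{\underline K-1}}{1-\sigma_1^{\underline K}}I_6\Big)\sum_{t=1}^T\eta_t+\frac{nR_X}{\alpha_T}+\frac{nR_Y}{\eta_T}+\Xi_T,$$ where $\underline K=\min_{t\in[T]}\{K_t\}$, $\Gamma_1=(1-\zeta/(4n^2))^{-1}$, $\sigma_1=1-\zeta/(4n^2)$, $$\Xi_T=nK_X\sum_{t=1}^T\frac1{\alpha_t}\|\boldsymbol{x}_{t+1}^*-B_t\boldsymbol{x}_t^*\|+nK_Y\sum_{t=1}^T\frac1{\eta_t}\|\boldsymbol{y}_{t+1}^*-C_t\boldsymbol{y}_t^*\|,$$ and $I_1=(n+2)\sum_{i=1}^n\big(L_X\|\boldsymbol{x}_{i,1}-\boldsymbol{x}_{avg,1}\|+L_Y\|\boldsymbol{y}_{i,1}-\boldsymbol{y}_{avg,1}\|\big)$, $I_2=n(n+2)\sum_{i=1}^n\big(L_X\|\boldsymbol{x}_{i,1}\|+L_Y\|\boldsymbol{y}_{i,1}\|\big)$,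 $I_3=\frac{nL_X^2}{\varrho_x}$, $I_4=\frac{n^2(n+2)L_X^2}{\varrho_x}$, $I_5=\frac{nL_Y^2}{\varrho_y}$, $I_6=\frac{n^2(n+2)L_Y^2}{\varrho_y}$, $R_X=\max_{\boldsymbol{x},\boldsymbol{u}\in\boldsymbol{X}}\Psi_{\mathcal R}^x(\boldsymbol{x},\boldsymbol{u})$, $R_Y=\max_{\boldsymbol{y},\boldsymbol{z}\in\boldsymbol{Y}}\Psi_{\mathcal R}^y(\boldsymbol{y},\boldsymbol{z})$.
   Context: **Problem.** $[m]=\{1,\dots,m\}$; $\|\cdot\|$ is a norm (on $\mathbb R^d$, resp. $\mathbb R^m$), $\|\cdot\|_*$ its dual norm, and matrix norms are the induced operator norms. $\boldsymbol{X}\subset\mathbb R^d$, $\boldsymbol{Y}\subset\mathbb R^m$ are convex compact sets with diameters (in $\|\cdot\|$) at most $M_X>0$, $M_Y>0$. For agents $i\in\mathcal V=[n]$ and times $t\ge1$, $f_{i,t}:\mathbb R^d\times\mathbb R^m\to\mathbb R$ is convex in the first and concave in the second argument; $f_t=\sum_{i=1}^n f_{i,t}$. For each $t$, $(\boldsymbol{x}_t^*,\boldsymbol{y}_t^* )\in\boldsymbol{X}\times\boldsymbol{Y}$ is a saddle point of $f_t$: $f_t(\boldsymbol{x}_t^*,\boldsymbol{y})\le f_t(\boldsymbol{x}_t^*,\boldsymbol{y}_t^* )\le f_t(\boldsymbol{x},\boldsymbol{y}_t^* )$ for all $\boldsymbol{x}\in\boldsymbol{X},\boldsymbol{y}\in\boldsymbol{Y}$.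 The expected dynamic saddle point regret of agent $j$ is $$\textbf{ESP-Regret}_d^j(T)=\Big|\mathbb E\Big[\sum_{t=1}^T f_t(\boldsymbol{x}_{j,t},\boldsymbol{y}_{j,t})-\sum_{t=1}^T f_t(\boldsymbol{x}_t^*,\boldsymbol{y}_t^* )\Big]\Big|.$$ **Network.** $\mathcal G_t=(\mathcal V,\mathcal E_t,A_t)$ is a directed time-varying graph with doubly stochastic weight matrix $A_t\in\mathbb R^{n\times n}$; $\mathcal N_i^{in}(t)=\{i\}\cup\{j:(j,i)\in\mathcal E_t\}$; for a fixed $0<\zeta<1$, $[A_t]_{ij}>\zeta$ if $j\in\mathcal N_i^{in}(t)$ and $[A_t]_{ij}=0$ otherwise. **Bregman divergences.** $\mathcal R^x:\mathbb R^d\to\mathbb R$, $\mathcal R^y:\mathbb R^m\to\mathbb R$ are differentiable and respectively $\varrho_x$- and $\varrho_y$-strongly convex (w.r.t. $\|\cdot\|$) on $\boldsymbol{X}$, $\boldsymbol{Y}$; $\Psi_{\mathcal R}^x(\boldsymbol{x}_a,\boldsymbol{x}_b)=\mathcal R^x(\boldsymbol{x}_a)-\mathcal R^x(\boldsymbol{x}_b)-\langle\nabla\mathcal R^x(\boldsymbol{x}_b),\boldsymbol{x}_a-\boldsymbol{x}_b\rangle$, and $\Psi_{\mathcal R}^y$ is defined analogously from $\mathcal R^y$. Thus $\Psi_{\mathcal R}^x(\boldsymbol{x}_a,\boldsymbol{x}_b)\ge\frac{\varrho_x}{2}\|\boldsymbol{x}_a-\boldsymbol{x}_b\|^2$ on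 $\boldsymbol{X}$, and likewise for $y$ on $\boldsymbol{Y}$. **Algorithm Multi-DOSMD-CCO.** Given initial decisions $\boldsymbol{x}_{i,1}\in\boldsymbol{X},\boldsymbol{y}_{i,1}\in\boldsymbol{Y}$, step sizes $\alpha_t,\eta_t>0$, positive integers $K_t$, and prediction matrices $B_t\in\mathbb R^{d\times d}$, $C_t\in\mathbb R^{m\times m}$. At each $t=1,\dots,T$, each agent $i$: (1) obtains stochastic gradients $\widetilde\nabla_{i,t}^x=\widetilde\nabla_{i,t}^x(\boldsymbol{x}_{i,t},\boldsymbol{y}_{i,t})$, $\widetilde\nabla_{i,t}^y=\widetilde\nabla_{i,t}^y(\boldsymbol{x}_{i,t},\boldsymbol{y}_{i,t})$ (from two independent stochastic oracles) and finds $\boldsymbol{z}_{i,t},\boldsymbol{v}_{i,t}$ with $\nabla\mathcal R^x(\boldsymbol{z}_{i,t})=\nabla\mathcal R^x(\boldsymbol{x}_{i,t})-\alpha_t\widetilde\nabla_{i,t}^x$, $\nabla\mathcal R^y(\boldsymbol{v}_{i,t})=\nabla\mathcal R^y(\boldsymbol{y}_{i,t})+\eta_t\widetilde\nabla_{i,t}^y$; (2) sets $\tilde{\boldsymbol{x}}_{i,t}=\arg\min_{\boldsymbol{x}\in\boldsymbol{X}}\Psi_{\mathcal R}^x(\boldsymbol{x},\boldsymbol{z}_{i,t})$, $\tilde{\boldsymbol{y}}_{i,t}=\arg\min_{\boldsymbol{y}\in\boldsymbol{Y}}\Psi_{\mathcal R}^y(\boldsymbol{y},\boldsymbol{v}_{i,t})$;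 (3) sets $\boldsymbol{s}_{i,t}^{x,1}=B_t\tilde{\boldsymbol{x}}_{i,t}$, $\boldsymbol{s}_{i,t}^{y,1}=C_t\tilde{\boldsymbol{y}}_{i,t}$; (4) for $k=1,\dots,K_t$ sets $\boldsymbol{s}_{i,t}^{x,k+1}=\sum_{j\in\mathcal N_i^{in}(t)}[A_t]_{ij}\boldsymbol{s}_{j,t}^{x,k}$, $\boldsymbol{s}_{i,t}^{y,k+1}=\sum_{j\in\mathcal N_i^{in}(t)}[A_t]_{ij}\boldsymbol{s}_{j,t}^{y,k}$; (5) sets $\boldsymbol{x}_{i,t+1}=\boldsymbol{s}_{i,t}^{x,K_t+1}$, $\boldsymbol{y}_{i,t+1}=\boldsymbol{s}_{i,t}^{y,K_t+1}$. Write $\boldsymbol{x}_{avg,t}=\frac1n\sum_{i}\boldsymbol{x}_{i,t}$, $\boldsymbol{y}_{avg,t}=\frac1n\sum_i\boldsymbol{y}_{i,t}$. $\mathcal F_t$ is the $\sigma$-field of the entire history of random variables up to time $t$. **Assumption 2.** For all $\boldsymbol{x}\in\boldsymbol{X},\boldsymbol{y}\in\boldsymbol{Y}$: $\mathbb E[\widetilde\nabla_{i,t}^x(\boldsymbol{x},\boldsymbol{y})|\mathcal F_{t-1}]=\nabla_xf_{i,t}(\boldsymbol{x},\boldsymbol{y})$, $\mathbb E[\widetilde\nabla_{i,t}^y(\boldsymbol{x},\boldsymbol{y})|\mathcal F_{t-1}]=\nabla_yf_{i,t}(\boldsymbol{x},\boldsymbol{y})$, $\mathbb E[\|\widetilde\nabla_{i,t}^x(\boldsymbol{x},\boldsymbol{y})\|_*^2|\mathcal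 F_{t-1}]\le L_X^2$, $\mathbb E[\|\widetilde\nabla_{i,t}^y(\boldsymbol{x},\boldsymbol{y})\|_*^2|\mathcal F_{t-1}]\le L_Y^2$. **Assumption 3.** (i) For all $\boldsymbol{x}_a,\boldsymbol{x}_b,\boldsymbol{x}_c\in\boldsymbol{X}$ and $\boldsymbol{y}_a,\boldsymbol{y}_b,\boldsymbol{y}_c\in\boldsymbol{Y}$: $|\Psi_{\mathcal R}^x(\boldsymbol{x}_a,\boldsymbol{x}_c)-\Psi_{\mathcal R}^x(\boldsymbol{x}_b,\boldsymbol{x}_c)|\le K_X\|\boldsymbol{x}_a-\boldsymbol{x}_b\|$, $|\Psi_{\mathcal R}^y(\boldsymbol{y}_a,\boldsymbol{y}_c)-\Psi_{\mathcal R}^y(\boldsymbol{y}_b,\boldsymbol{y}_c)|\le K_Y\|\boldsymbol{y}_a-\boldsymbol{y}_b\|$. (ii) For all $\boldsymbol{x},\boldsymbol{z}_i\in\mathbb R^d$, $\boldsymbol{y},\boldsymbol{v}_i\in\mathbb R^m$ and all $\boldsymbol{s}$ in the probability simplex of $\mathbb R^n$: $\Psi_{\mathcal R}^x(\boldsymbol{x},\sum_i[\boldsymbol{s}]_i\boldsymbol{z}_i)\le\sum_i[\boldsymbol{s}]_i\Psi_{\mathcal R}^x(\boldsymbol{x},\boldsymbol{z}_i)$ and $\Psi_{\mathcal R}^y(\boldsymbol{y},\sum_i[\boldsymbol{s}]_i\boldsymbol{v}_i)\le\sum_i[\boldsymbol{s}]_i\Psi_{\mathcal R}^y(\boldsymbol{y},\boldsymbol{v}_i)$.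 **Assumption 4.** For all $t\in[T]$, $\boldsymbol{x}_a,\boldsymbol{x}_b\in\boldsymbol{X}$, $\boldsymbol{y}_a,\boldsymbol{y}_b\in\boldsymbol{Y}$: $\Psi_{\mathcal R}^x(B_t\boldsymbol{x}_a,B_t\boldsymbol{x}_b)\le\Psi_{\mathcal R}^x(\boldsymbol{x}_a,\boldsymbol{x}_b)$, $\Psi_{\mathcal R}^y(C_t\boldsymbol{y}_a,C_t\boldsymbol{y}_b)\le\Psi_{\mathcal R}^y(\boldsymbol{y}_a,\boldsymbol{y}_b)$; $\|B_t\|\le1$, $\|C_t\|\le1$; and $B_t\boldsymbol{x}\in\boldsymbol{X}$, $C_t\boldsymbol{y}\in\boldsymbol{Y}$ whenever $\boldsymbol{x}\in\boldsymbol{X}$, $\boldsymbol{y}\in\boldsymbol{Y}$. **Assumption 5.** $\mathcal G_t$ is strongly connected for every $t\in[T]$.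
   Formalization: The step sizes α_t and η_t are additionally assumed nonincreasing on [T] (the bound fails for arbitrary positive step sizes), and Assumption 2 is read as holding at F_{t-1}-measurable random points of X×Y, not only at fixed ones. *)

(* Defs.v *)
From mathcomp Require Import all_boot all_order all_algebra.
From mathcomp Require Import all_classical all_reals all_analysis.
Import Order.TTheory GRing.Theory Num.Theory.
Import numFieldNormedType.Exports.

Set Implicit Arguments.
Unset Strict Implicit.
Unset Printing Implicit Defensive.

Local Open Scope classical_set_scope.
Local Open Scope ring_scope.

(* R^d is 'cV[R]_d.  The norm of the problem is an arbitrary function [N]
   satisfying [is_norm]; the library's own (sup) norm on 'cV[R]_d only serves
   to speak of compactness and differentiability, which do not depend on the
   choice of a norm in finite dimension. *)

Record is_norm (R : realType) (d : nat) (N : 'cV[R]_d -> R) : Prop := IsNorm {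
  is_norm_triangle : forall u v, N (u + v) <= N u + N v;
  is_norm_homog : forall (a : R) u, N (a *: u) = `|a| * N u;
  is_norm_eq0 : forall u, N u = 0 -> u = 0
}.

Definition dotv (R : realType) (d : nat) (u v : 'cV[R]_d) : R :=
  \sum_k u k 0 * v k 0.

Definition dual_norm (R : realType) (d : nat) (N : 'cV[R]_d -> R)
    (g : 'cV[R]_d) : R :=
  sup [set dotv g u | u in [set u | N u <= 1]].

Definition op_norm (R : realType) (d : nat) (N : 'cV[R]_d -> R)
    (B : 'M[R]_d) : R :=
  sup [set N (B *m u) | u in [set u | N u <= 1]].

Definition grad (R : realType) (d : nat) (h : 'cV[R]_d -> R)
    (u : 'cV[R]_d) : 'cV[R]_d :=
  \col_k 'D_(delta_mx k 0) (h : 'cV[R]_d -> R^o) u.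

Definition strongly_convex_on (R : realType) (d : nat) (N : 'cV[R]_d -> R)
    (rho : R) (X : set 'cV[R]_d) (phi : 'cV[R]_d -> R) : Prop :=
  forall (u v : 'cV[R]_d) (l : R), X u -> X v -> 0 <= l <= 1 ->
    phi (l *: u + (1 - l) *: v) <=
      l * phi u + (1 - l) * phi v - rho / 2 * l * (1 - l) * N (u - v) ^+ 2.

Definition bregman (R : realType) (d : nat) (phi : 'cV[R]_d -> R)
    (a b : 'cV[R]_d) : R :=
  phi a - phi b - dotv (grad phi b) (a - b).

Definition saddle_point (R : realType) (d m : nat) (X : set 'cV[R]_d)
    (Y : set 'cV[R]_m) (F : 'cV[R]_d -> 'cV[R]_m -> R)
    (xs : 'cV[R]_d) (ys : 'cV[R]_m) : Prop :=
  [/\ X xs, Y ys,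
      forall y, Y y -> F xs y <= F xs ys &
      forall x, X x -> F xs ys <= F x ys].

Definition simplex (R : realType) (n : nat) (s : 'I_n -> R) : Prop :=
  (forall i, 0 <= s i) /\ \sum_i s i = 1.

Definition doubly_stochastic (R : realType) (n : nat) (A : 'M[R]_n) : Prop :=
  [/\ forall i j, 0 <= A i j,
      forall i, \sum_j A i j = 1 &
      forall j, \sum_i A i j = 1].

(* [E j i] means that (j, i) is an edge, i.e. that i hears from j. *)
Definition in_nbhd (n : nat) (E : rel 'I_n) (i : 'I_n) : {set 'I_n} :=
  [set j | (j == i) || E j i].

Definition strongly_connected (n : nat) (E : rel 'I_n) : Prop :=
  forall i j, connect E i j.

Definition random_vector (dd : measure_display) (Om : measurableType dd)
    (R : realType) (d : nat) (U : Om -> 'cV[R]_d) : Prop :=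
  forall k, measurable_fun setT (fun w => U w k 0).

(* The sigma-algebra generated by a random vector is generated by
   [coord_events U]; hence U is measurable with respect to a sigma-algebra G
   iff [coord_events U `<=` G]. *)
Definition coord_events (Om : Type) (R : realType) (d : nat)
    (U : Om -> 'cV[R]_d) : set (set Om) :=
  \bigcup_(k in [set: 'I_d])
    preimage_set_system setT (fun w => U w k 0) measurable.

Definition independent_systems (dd : measure_display)
    (Om : measurableType dd) (R : realType) (P : probability Om R)
    (G H : set (set Om)) : Prop :=
  forall A B, G A -> H B -> P (A `&` B) = (P A * P B)%E.

(* [V] is a version of the conditional expectation E[U | G]. *)
Definition is_cond_exp (dd : measure_display) (Om : measurableType dd)
    (R : realType) (P : probability Om R) (G : set (set Om))
    (U V : Om -> R) : Prop :=
  [/\ P.-integrable setT (EFin \o U),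
      P.-integrable setT (EFin \o V),
      preimage_set_system setT V measurable `<=` G &
      forall A, G A ->
        (\int[P]_(w in A) (U w)%:E = \int[P]_(w in A) (V w)%:E)%E].

Definition is_cond_expv (dd : measure_display) (Om : measurableType dd)
    (R : realType) (P : probability Om R) (G : set (set Om)) (d : nat)
    (U V : Om -> 'cV[R]_d) : Prop :=
  forall k, is_cond_exp P G (fun w => U w k 0) (fun w => V w k 0).

(* Unbiasedness and conditional second moment bound of a stochastic oracle [g]
   for the field [dg].  The query point ranges over the G-measurable random
   points of X x Y (in particular over the constants), because the oracle is
   queried at the random decisions of the agents: for deterministic points
   alone the exceptional null sets would depend on the point, and nothing
   could be said about the oracle at a random one. *)
Definition unbiased_oracle (dd : measure_display) (Om : measurableType dd)
    (R : realType) (P : probability Om R) (G : set (set Om)) (d m p : nat)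
    (X : set 'cV[R]_d) (Y : set 'cV[R]_m) (N : 'cV[R]_p -> R) (L : R)
    (g : 'cV[R]_d -> 'cV[R]_m -> Om -> 'cV[R]_p)
    (dg : 'cV[R]_d -> 'cV[R]_m -> 'cV[R]_p) : Prop :=
  forall (a : Om -> 'cV[R]_d) (b : Om -> 'cV[R]_m),
    (forall w, X (a w)) -> (forall w, Y (b w)) ->
    coord_events a `<=` G -> coord_events b `<=` G ->
    is_cond_expv P G (fun w => g (a w) (b w) w) (fun w => dg (a w) (b w)) /\
    exists2 W : Om -> R,
      is_cond_exp P G (fun w => dual_norm N (g (a w) (b w) w) ^+ 2) W &
      {ae P, forall w, W w <= L ^+ 2}.

Definition oracle_sigma (Om : Type) (R : realType) (d m p : nat)
    (X : set 'cV[R]_d) (Y : set 'cV[R]_m)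
    (g : 'cV[R]_d -> 'cV[R]_m -> Om -> 'cV[R]_p) : set (set Om) :=
  <<s \bigcup_(x in X) \bigcup_(y in Y) coord_events (g x y) >>.

(* The random variables that the algorithm produces for one of its two blocks
   of variables.  For the x-block: [decision i t] is x_{i,t},
   [unprojected i t] is z_{i,t}, [projected i t] is x~_{i,t} and
   [consensus i t k] is s_{i,t}^{x,k}. *)
Record block_run (Om : Type) (R : realType) (n d : nat) := BlockRun {
  decision : 'I_n -> nat -> Om -> 'cV[R]_d;
  unprojected : 'I_n -> nat -> Om -> 'cV[R]_d;
  projected : 'I_n -> nat -> Om -> 'cV[R]_d;
  consensus : 'I_n -> nat -> nat -> Om -> 'cV[R]_d
}.

Definition oracle_output (Om : Type) (R : realType) (n d m p : nat)
    (g : 'I_n -> nat -> 'cV[R]_d -> 'cV[R]_m -> Om -> 'cV[R]_p)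
    (rx : block_run Om R n d) (ry : block_run Om R n m)
    (i : 'I_n) (t : nat) (w : Om) : 'cV[R]_p :=
  g i t (decision rx i t w) (decision ry i t w) w.

(* One block of the algorithm, with horizon T and gradient samples [g].
   [step t] is the signed step size: alpha_t for the descent in x, and
   - eta_t for the ascent in y. *)
Record block_algorithm (dd : measure_display) (Om : measurableType dd)
    (R : realType) (n d : nat) (T : nat) (phi : 'cV[R]_d -> R)
    (X : set 'cV[R]_d) (step : nat -> R) (K : nat -> nat)
    (E : nat -> rel 'I_n) (A : nat -> 'M[R]_n) (B : nat -> 'M[R]_d)
    (u1 : 'I_n -> 'cV[R]_d) (g : 'I_n -> nat -> Om -> 'cV[R]_d)
    (r : block_run Om R n d) : Prop := BlockAlgorithm {
  block_random : forall i t, (1 <= t <= T)%N ->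
    [/\ random_vector (decision r i t), random_vector (unprojected r i t),
        random_vector (projected r i t) &
        forall k, (1 <= k <= (K t).+1)%N ->
          random_vector (consensus r i t k)];
  block_init : forall i w, decision r i 1 w = u1 i;
  block_step : forall i t w, (1 <= t <= T)%N ->
    grad phi (unprojected r i t w) =
      grad phi (decision r i t w) - step t *: g i t w;
  block_proj : forall i t w, (1 <= t <= T)%N ->
    X (projected r i t w) /\
    (forall u, X u -> bregman phi (projected r i t w) (unprojected r i t w)
                      <= bregman phi u (unprojected r i t w));
  block_predict : forall i t w, (1 <= t <= T)%N ->
    consensus r i t 1 w = B t *m projected r i t w;
  block_consensus : forall i t k w, (1 <= t <= T)%N -> (1 <= k <= K t)%N ->
    consensus r i t k.+1 w =
      \sum_(j in in_nbhd (E t) i) A t i j *: consensus r j t k w;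
  block_next : forall i t w, (1 <= t <= T)%N ->
    decision r i t.+1 w = consensus r i t (K t).+1 w
}.

Definition block_events (Om : Type) (R : realType) (n d : nat)
    (K : nat -> nat) (r : block_run Om R n d)
    (g : 'I_n -> nat -> Om -> 'cV[R]_d) (s : nat) : set (set Om) :=
  \bigcup_(i in [set: 'I_n])
    (coord_events (decision r i s) `|` coord_events (g i s) `|`
     coord_events (unprojected r i s) `|` coord_events (projected r i s) `|`
     \bigcup_(k in [set k | (1 <= k <= (K s).+1)%N])
       coord_events (consensus r i s k)).

(* The sigma-field generated by all the random variables of the rounds
   1, ..., t.  As x_{i,t+1} is the last consensus iterate of round t, it is
   measurable with respect to [history t]. *)
Definition history (Om : Type) (R : realType) (n d m : nat) (K : nat -> nat)
    (gx : 'I_n -> nat -> 'cV[R]_d -> 'cV[R]_m -> Om -> 'cV[R]_d)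
    (gy : 'I_n -> nat -> 'cV[R]_d -> 'cV[R]_m -> Om -> 'cV[R]_m)
    (rx : block_run Om R n d) (ry : block_run Om R n m)
    (t : nat) : set (set Om) :=
  <<s \bigcup_(s in [set s | (1 <= s <= t)%N])
        (block_events K rx (oracle_output gx rx ry) s `|`
         block_events K ry (oracle_output gy rx ry) s) >>.

Definition network_function (R : realType) (n d m : nat)
    (f : 'I_n -> nat -> 'cV[R]_d -> 'cV[R]_m -> R) (t : nat)
    (x : 'cV[R]_d) (y : 'cV[R]_m) : R :=
  \sum_i f i t x y.

Definition esp_regret (dd : measure_display) (Om : measurableType dd)
    (R : realType) (P : probability Om R) (n d m : nat)
    (f : 'I_n -> nat -> 'cV[R]_d -> 'cV[R]_m -> R)
    (rx : block_run Om R n d) (ry : block_run Om R n m)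
    (xs : nat -> 'cV[R]_d) (ys : nat -> 'cV[R]_m) (T : nat) (j : 'I_n)
    : \bar R :=
  let loss := fun w =>
    \sum_(1 <= t < T.+1)
      network_function f t (decision rx j t w) (decision ry j t w) -
    \sum_(1 <= t < T.+1) network_function f t (xs t) (ys t) in
  `| 'E_P[loss] |%E.

Definition average (R : realType) (n d : nat) (u : 'I_n -> 'cV[R]_d)
    : 'cV[R]_d :=
  n%:R^-1 *: \sum_i u i.

(* A supremum in R.  Under the hypothesis
   |bregman phi a c - bregman phi b c| <= K N(a - b) on a bounded X, the set is
   bounded above (take b = c). *)
Definition bregman_diameter (R : realType) (d : nat) (phi : 'cV[R]_d -> R)
    (X : set 'cV[R]_d) : R :=
  sup [set bregman phi p.1 p.2 | p in X `*` X].

(* Main.v *)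
Require Import Defs.
From mathcomp Require Import all_boot all_order all_algebra.
From mathcomp Require Import all_classical all_reals all_analysis.
From mathcomp Require Import measurable_realfun ring lra.
Import Order.TTheory GRing.Theory Num.Theory.
Import numFieldNormedType.Exports.

Set Implicit Arguments.
Unset Strict Implicit.
Unset Printing Implicit Defensive.

Local Open Scope classical_set_scope.
Local Open Scope ring_scope.

(* The regret is bounded from above using the x-block alone and from below using
   the y-block alone.  By the saddle point inequality and first-order convexity,
   the gap of f_t at agent j is at most (n + 2) times the sum of the distances of
   the agents to their average, plus the linearised regrets <grad f_{i,t}, x_i - x*>.
   Both are estimated for each outcome separately:
   - x_{i,t} is a sum of contributions of the initial points and of the mirror
     steps of the earlier rounds, and p averaging steps contract the deviation of
     each of them by sigma^p, sigma = 1 - zeta / (4 n^2).  One step decreases the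
     sum of squares by the weights across the cuts {values <= s}, and each cut of
     a strongly connected graph carries a weight at least zeta / 2;
   - mirror descent telescopes: the averaging step does not increase the sum of
     the Bregman divergences, since A_t is doubly stochastic and the divergence is
     convex in its second argument.
   Expectations enter only at the end, to replace grad f_{i,t} by its sample: the
   decision x_{i,t} is bounded and measurable with respect to the past. *)

(** * Norms, gradients and Bregman divergences *)

(** Three obstacles shape the argument. The loss at the random decisions is never shown to be
    measurable: each one-sided bound dominates it, outcome by outcome, by an integrable function,
    and only monotonicity of the integral is used. The consensus errors are of first order in the
    sampled gradients while only second moments are controlled: [L * |g| <= (|g|^2 + L^2) / 2]
    converts one into the other. A conditional expectation is given by its integrals over events
    only, so the product rule with a bounded measurable factor has to be derived from events.

    The bound from below is the bound from above for the game with the players exchanged and f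
    negated. Both contain the consensus errors of the two blocks but the mirror descent terms of
    only one; the terms of the other block are nonnegative and complete each to the common bound.

    The 4 in sigma: one averaging multiplies the sum of squares by at most [1 - c] with
    [c = zeta / (2 n^2)], and [1 - c <= (1 - c / 2)^2]. *)

Section DotProduct.
Context (R : realType) (d : nat).
Implicit Types (u v w : 'cV[R]_d) (a : R).

Lemma dotvC u v : dotv u v = dotv v u.
Proof. by apply: eq_bigr => k _; rewrite mulrC. Qed.

Lemma dotvDr u v w : dotv u (v + w) = dotv u v + dotv u w.
Proof. by rewrite -big_split; apply: eq_bigr => k _; rewrite mxE mulrDr. Qed.

Lemma dotvZr a u v : dotv u (a *: v) = a * dotv u v.
Proof. by rewrite mulr_sumr; apply: eq_bigr => k _; rewrite mxE mulrCA. Qed.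

Lemma dotvNr u v : dotv u (- v) = - dotv u v.
Proof. by rewrite -scaleN1r dotvZr mulN1r. Qed.

Lemma dotvBr u v w : dotv u (v - w) = dotv u v - dotv u w.
Proof. by rewrite dotvDr dotvNr. Qed.

Lemma dotvDl u v w : dotv (u + v) w = dotv u w + dotv v w.
Proof. by rewrite dotvC dotvDr !(dotvC w). Qed.

Lemma dotvZl a u v : dotv (a *: u) v = a * dotv u v.
Proof. by rewrite dotvC dotvZr dotvC. Qed.

Lemma dotvNl u v : dotv (- u) v = - dotv u v.
Proof. by rewrite dotvC dotvNr dotvC. Qed.

Lemma dotvBl u v w : dotv (u - v) w = dotv u w - dotv v w.
Proof. by rewrite dotvDl dotvNl. Qed.

Lemma dotv0r u : dotv u 0 = 0.
Proof. by apply: big1 => k _; rewrite mxE mulr0. Qed.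

End DotProduct.

Lemma mx_entry_le_norm (R : realType) (m n : nat) (u : 'M[R]_(m, n)) i j :
  `|u i j| <= `|u|.
Proof.
rewrite [leRHS]/Num.Def.normr/= mx_normrE.
by apply/bigmax_geP; right => /=; exists (i, j).
Qed.

(** Transfers the norm between columns and rows: the extreme value theorem applied below speaks of
    row vectors. *)
Lemma mx_norm_trmx (R : realType) (m n : nat) (u : 'M[R]_(m, n)) : `|u^T| = `|u|.
Proof.
have le_tr p q (v : 'M[R]_(p, q)) : `|v^T| <= `|v|.
  rewrite [leLHS]/Num.Def.normr/= mx_normrE.
  apply/bigmax_leP; split => [|[i j] _ /=]; first exact: normr_ge0.
  by rewrite mxE mx_entry_le_norm.
by apply/eqP; rewrite eq_le le_tr/= -[in leLHS](trmxK u) le_tr.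
Qed.

Section Norms.
Context (R : realType) (d : nat) (N : 'cV[R]_d -> R) (hN : is_norm N).
Implicit Types u v g : 'cV[R]_d.

Lemma is_norm0 : N 0 = 0.
Proof. by rewrite -(scale0r 0) (is_norm_homog hN) normr0 mul0r. Qed.

Lemma is_normN u : N (- u) = N u.
Proof. by rewrite -scaleN1r (is_norm_homog hN) normrN normr1 mul1r. Qed.

Lemma is_norm_ge0 u : 0 <= N u.
Proof.
have := is_norm_triangle hN u (- u); rewrite subrr is_norm0 is_normN => h.
by rewrite -(pmulrn_lge0 _ (isT : (0 < 2)%N)) mulr2n.
Qed.

Lemma is_norm_distC u v : N (u - v) = N (v - u).
Proof. by rewrite -is_normN opprB. Qed.

Lemma is_norm_sum (I : Type) (r : seq I) (Q : pred I) (F : I -> 'cV[R]_d) :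
  N (\sum_(i <- r | Q i) F i) <= \sum_(i <- r | Q i) N (F i).
Proof.
elim/big_rec2: _ => [|i a b _ h]; first by rewrite is_norm0.
by apply: le_trans (is_norm_triangle hN _ _) _; rewrite lerD2l.
Qed.

(** Expand [u] in the canonical basis. This bound makes [N] continuous for the sup norm, on which
    the converse bound rests. *)
Lemma is_norm_le_mx_norm : exists2 C, 0 <= C & forall u, N u <= C * `|u|.
Proof.
exists (\sum_k N (delta_mx k 0)); first by apply: sumr_ge0 => k _; exact: is_norm_ge0.
move=> u; rewrite [in leLHS](matrix_sum_delta u) mulr_suml.
apply: le_trans (is_norm_sum _ _ _) _; apply: ler_sum => k _.
rewrite big_ord1 (is_norm_homog hN) mulrC ler_wpM2l ?is_norm_ge0//.
exact: mx_entry_le_norm.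
Qed.

Lemma is_norm_dist u v : `|N u - N v| <= N (u - v).
Proof.
rewrite ler_norml; apply/andP; split.
  rewrite lerNl opprB lerBlDr is_norm_distC.
  by apply: le_trans (is_norm_triangle hN _ _); rewrite subrK.
by rewrite lerBlDr; apply: le_trans (is_norm_triangle hN _ _); rewrite subrK.
Qed.

(* The continuous function N attains a positive minimum on the sup-norm unit
   sphere, which is compact. *)
Lemma mx_norm_le_is_norm : exists2 C, 0 <= C & forall u, `|u| <= C * N u.
Proof.
pose S := [set v : 'rV[R]_d | `|v| = 1].
have [C C0 NC] := is_norm_le_mx_norm.
have Ncont : {within S, continuous (fun v : 'rV[R]_d => N v^T : R)}.
  apply: continuous_subspaceT => v.
  apply/(@cvgrPdist_le _ _ _ (nbhs v) (@nbhs_filter _ v)) => e e0.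
  have e1 : 0 < e / (C + 1) by rewrite divr_gt0// ltr_wpDl.
  have : \forall w \near v, `|v - w| <= e / (C + 1) by exact: (@cvgr_dist_le _ _ _ (nbhs v) _ id).
  apply: (@filterS _ _ (@nbhs_filter _ v)) => w h.
  apply: le_trans (is_norm_dist _ _) _.
  apply: le_trans (NC _) _.
  rewrite -linearB/= mx_norm_trmx.
  move: h; rewrite ler_pdivlMr ?ltr_wpDl// mulrDr mulr1 mulrC => h.
  by apply: le_trans h; rewrite lerDl.
have Scl : closed S.
  have -> : S = (fun v : 'rV[R]_d => `|v|) @^-1` [set 1].
    by [].
  apply: (@preimage_closed 'rV[R]_d R (fun v : 'rV[R]_d => `|v|)); last exact: closed_eq.
  by move=> v _; exact: (@norm_continuous R 'rV[R]_d v).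
have Sco : compact S.
  apply: bounded_closed_compact => //.
  exists 1; split => // x x1 v; rewrite /S/= => ->; exact: ltW.
(* The sphere is empty only when [d] is 0; every vector is then 0 and the constant 0 serves. *)
have [[v0 Sv0]|S0] := pselect (S !=set0); last first.
  exists 0 => // u; rewrite mul0r.
  have [->|u0] := eqVneq u 0; first by rewrite normr0.
  exfalso; apply: S0; exists (`|u|^-1 *: u^T); rewrite /S /= normrZ mx_norm_trmx.
  by rewrite normfV normr_id mulVf// normr_eq0.
have [v Sv vmin] := EVT_min_rV (ex_intro _ v0 Sv0) Sco Ncont.
have Nv0 : 0 < N v^T.
  rewrite lt_neqAle is_norm_ge0 andbT eq_sym; apply/eqP => /(is_norm_eq0 hN) v0'.
  by move: Sv; rewrite inE /S/= -(trmxK v) v0' trmx0 normr0 => /eqP; rewrite eq_sym oner_eq0.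
exists (N v^T)^-1 => [|u]; first by rewrite invr_ge0 ltW.
have [->|u0] := eqVneq u 0; first by rewrite normr0 mulr_ge0 ?invr_ge0 ?is_norm_ge0.
rewrite ler_pdivlMl// mulrC -ler_pdivlMl ?normr_gt0//.
have /vmin : `|u|^-1 *: u^T \in S.
  rewrite inE /S /= normrZ mx_norm_trmx.
  by rewrite normfV normr_id mulVf// normr_eq0.
by rewrite linearZ/= trmxK (is_norm_homog hN) ger0_norm ?invr_ge0.
Qed.

Lemma coord_le_is_norm : exists2 C, 0 <= C & forall u k, `|u k 0| <= C * N u.
Proof.
have [C C0 hC] := mx_norm_le_is_norm; exists C => // u k.
exact: le_trans (mx_entry_le_norm _ _ _) (hC u).
Qed.

Lemma dotv_le_is_norm g : exists C, forall u, N u <= 1 -> dotv g u <= C.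
Proof.
have [C C0 hC] := coord_le_is_norm; exists (\sum_k `|g k 0| * C) => u u1.
apply: ler_sum => k _; apply: le_trans (ler_norm _) _; rewrite normrM.
by rewrite ler_wpM2l//; apply: le_trans (hC _ _) _; rewrite ler_piMr.
Qed.

(** A real [sup] carries information only on a nonempty bounded set; equivalence of norms supplies
    the bound. *)
Lemma dual_norm_has_sup g : has_sup [set dotv g u | u in [set u | N u <= 1]].
Proof.
split; first by exists 0, 0; rewrite /= ?is_norm0 ?dotv0r.
by have [C hC] := dotv_le_is_norm g; exists C => _ [u /hC ? <-].
Qed.

Lemma dual_norm_ge0 g : 0 <= dual_norm N g.
Proof.
apply: ub_le_sup; first exact: (dual_norm_has_sup g).2.
by exists 0; rewrite /= ?is_norm0 ?dotv0r.
Qed.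

Lemma is_norm_normalize u : u != 0 -> N ((N u)^-1 *: u) = 1.
Proof.
move=> u0; have Nu0 : N u != 0 by apply: contra u0 => /eqP/(is_norm_eq0 hN)->.
by rewrite (is_norm_homog hN) ger0_norm ?invr_ge0 ?is_norm_ge0// mulVf.
Qed.

Lemma dotv_le_dual g u : dotv g u <= dual_norm N g * N u.
Proof.
have [->|u0] := eqVneq u 0; first by rewrite dotv0r is_norm0 mulr0.
have Nu0 : 0 < N u.
  rewrite lt_neqAle is_norm_ge0 andbT eq_sym.
  by apply: contra u0 => /eqP/(is_norm_eq0 hN)->.
rewrite -ler_pdivrMr// mulrC -dotvZr; apply: ub_le_sup.
  exact: (dual_norm_has_sup g).2.
by exists ((N u)^-1 *: u) => //=; rewrite is_norm_normalize.
Qed.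

Lemma dual_norm_le g L : (forall u, N u <= 1 -> dotv g u <= L) -> dual_norm N g <= L.
Proof.
move=> h; apply: ge_sup; first exact: (dual_norm_has_sup g).1.
by move=> _ [u /h ? <-].
Qed.

Lemma dual_normN g : dual_norm N (- g) = dual_norm N g.
Proof.
congr sup; apply/seteqP; split => _ [u /= u1 <-]; exists (- u);
  by rewrite ?is_normN//= ?dotvNl ?dotvNr ?opprK.
Qed.

Lemma op_norm_le1 (B : 'M[R]_d) : op_norm N B <= 1 -> forall u, N (B *m u) <= N u.
Proof.
move=> B1 u; have [->|u0] := eqVneq u 0; first by rewrite mulmx0.
have Nu0 : 0 < N u.
  rewrite lt_neqAle is_norm_ge0 andbT eq_sym.
  by apply: contra u0 => /eqP/(is_norm_eq0 hN)->.
(* The supremum defining the operator norm is finite: expand [B *m v] over the columns of [B], with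
   coefficients bounded by equivalence of norms. *)
have ubB : has_ubound [set N (B *m v) | v in [set v | N v <= 1]].
  have [C C0 hC] := coord_le_is_norm.
  exists (\sum_k C * N (col k B)) => _ [v v1 <-].
  have -> : B *m v = \sum_k v k 0 *: col k B.
    apply/colP => i; rewrite !mxE summxE; apply: eq_bigr => k _.
    by rewrite !mxE mulrC.
  apply: le_trans (is_norm_sum _ _ _) _; apply: ler_sum => k _.
  rewrite (is_norm_homog hN) ler_wpM2r ?is_norm_ge0//.
  by apply: le_trans (hC _ _) _; rewrite ler_piMr.
rewrite -(mul1r (N u)) -ler_pdivrMr//.
have -> : N (B *m u) / N u = N (B *m ((N u)^-1 *: u)).
  by rewrite -scalemxAr (is_norm_homog hN) ger0_norm ?invr_ge0 1?ltW// mulrC.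
apply: le_trans B1; apply: ub_le_sup => //.
by exists ((N u)^-1 *: u) => //=; rewrite is_norm_normalize.
Qed.

End Norms.

(** * Gradients, first-order convexity and convex combinations *)

Section Gradient.
Context (R : realType) (d : nat).
Implicit Types (h phi : 'cV[R]_d -> R) (u v w : 'cV[R]_d).

Lemma derive_dotv h u w : differentiable (h : 'cV[R]_d -> R^o) u ->
  'D_w (h : 'cV[R]_d -> R^o) u = dotv (grad h u) w.
Proof.
move=> hu; rewrite deriveE// [in LHS](matrix_sum_delta w) linear_sum.
apply: eq_bigr => k _; rewrite big_ord1 linearZ/= mxE deriveE//.
by rewrite mulrC.
Qed.

Lemma cvg_difference_quotient h u w : differentiable (h : 'cV[R]_d -> R^o) u ->
  l^-1 * (h (u + l *: w) - h u) @[l --> 0^'+] --> dotv (grad h u) w.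
Proof.
move=> hu; rewrite -derive_dotv//.
have /cvg_ex[D hD] := @diff_derivable _ _ _ (h : 'cV[R]_d -> R^o) u w hu.
have -> : 'D_w (h : 'cV[R]_d -> R^o) u = D by apply: cvg_lim hD.
move=> S hS; have : nbhs (0 : R) (fun l => l != 0 ->
    S (l^-1 *: (h (l *: w + u) - h u))) by exact: hD.
move=> h0; suff h1 : nbhs (0 : R) (fun l => 0 < l -> S (l^-1 * (h (u + l *: w) - h u))) by exact: h1.
move: h0; apply: (@filterS _ _ (@nbhs_filter _ (0 : R))) => l hl l0.
by have := hl (lt0r_neq0 l0); rewrite [l *: w + u]addrC.
Qed.

(** Divide by [l] and let it decrease to 0. The term in [l ^+ 2] vanishes; it makes room for the
    quadratic remainder of strong convexity. *)
Lemma dotv_grad_le h u w (c k : R) : differentiable (h : 'cV[R]_d -> R^o) u ->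
  (forall l, 0 < l <= 1 -> h (u + l *: w) - h u <= l * c + l ^+ 2 * k) ->
  dotv (grad h u) w <= c.
Proof.
move=> hu hle.
have : c + l * k @[l --> 0^'+] --> c + 0 * k.
  apply: cvgD; first exact: cvg_cst.
  by apply: cvgM (cvg_cst _); exact: cvg_within.
rewrite mul0r addr0 => cvg_c.
apply: ler_cvg_to (cvg_difference_quotient hu) cvg_c _.
near=> l.
have l0 : 0 < l by [].
rewrite ler_pdivrMl// mulrDr mulrA -expr2; apply: hle; rewrite l0/=.
by near: l; exact: nbhs_right_le.
Unshelve. all: by end_near. Qed.

Lemma dotv_grad_ge h u w (c k : R) : differentiable (h : 'cV[R]_d -> R^o) u ->
  (forall l, 0 < l <= 1 -> l * c + l ^+ 2 * k <= h (u + l *: w) - h u) ->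
  c <= dotv (grad h u) w.
Proof.
move=> hu hle.
have : c + l * k @[l --> 0^'+] --> c + 0 * k.
  apply: cvgD; first exact: cvg_cst.
  by apply: cvgM (cvg_cst _); exact: cvg_within.
rewrite mul0r addr0 => cvg_c.
apply: ler_cvg_to cvg_c (cvg_difference_quotient hu) _.
near=> l.
have l0 : 0 < l by [].
rewrite ler_pdivlMl// mulrDr mulrA -expr2; apply: hle; rewrite l0/=.
by near: l; exact: nbhs_right_le.
Unshelve. all: by end_near. Qed.

Lemma unit_interval_spec (l : R) : 0 <= l <= 1 ->
  Itv.spec (@Itv.num_sem R) (Itv.Real `[0%Z, 1%Z]) l.
Proof.
by case/andP=> l0 l1; rewrite /= /Itv.num_sem/= in_itv/= ger0_real// l0.
Qed.

Lemma convex_functionP (f : 'cV[R]_d -> R) : convex_function setT f ->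
  forall u v (l : R), 0 <= l <= 1 -> f (v + l *: (u - v)) <= f v + l * (f u - f v).
Proof.
move=> cf u v l l01.
have i01 := unit_interval_spec l01.
have := cf (Itv.mk i01) u v (mem_setT _) (mem_setT _).
rewrite /conv/= => h.
have -> : v + l *: (u - v) = l *: u + (1 - l) *: v.
  by rewrite scalerBr scalerBl scale1r addrCA addrA.
apply: le_trans h _; rewrite le_eqVlt; apply/orP; left; apply/eqP.
by transitivity (l * f u + (1 - l) * f v); [by []|ring].
Qed.

Lemma convex_setP (X : set 'cV[R]_d) : convex_set X ->
  forall u v (l : R), X u -> X v -> 0 <= l <= 1 -> X (l *: u + (1 - l) *: v).
Proof.
move=> cX u v l Xu Xv l01.
have i01 := unit_interval_spec l01.
by have := cX u v (Itv.mk i01) (mem_set Xu) (mem_set Xv); rewrite inE.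
Qed.

Lemma convex_first_order f u v : convex_function setT f ->
  differentiable (f : 'cV[R]_d -> R^o) u -> dotv (grad f u) (v - u) <= f v - f u.
Proof.
move=> cf df; apply: (@dotv_grad_le _ _ _ _ 0 df) => l /andP[l0 l1].
rewrite mulr0 addr0 lerBlDl; apply: convex_functionP => //.
by rewrite (ltW l0).
Qed.

Lemma concave_first_order f u v : convex_function setT (fun x => - f x) ->
  differentiable (f : 'cV[R]_d -> R^o) u -> f v - f u <= dotv (grad f u) (v - u).
Proof.
move=> cf df; apply: (@dotv_grad_ge _ _ _ _ 0 df) => l /andP[l0 l1].
have /(_ v u l) := convex_functionP cf; rewrite (ltW l0) => /(_ l1); lra.
Qed.

(** The weights stay unnormalised so that the induction applies to the tail of the list, whose
    barycenter is then combined with the head; a tail of total weight 0 is dropped. *)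
Lemma convex_set_barycenter (I : Type) (r : seq I) (X : set 'cV[R]_d) (s : I -> R)
    (z : I -> 'cV[R]_d) :
  convex_set X -> (forall i, 0 <= s i) -> (forall i, X (z i)) ->
  0 < \sum_(i <- r) s i ->
  X ((\sum_(i <- r) s i)^-1 *: \sum_(i <- r) s i *: z i).
Proof.
move=> cX s0 Xz; elim: r => [|a r IH]; first by rewrite big_nil ltxx.
rewrite !big_cons => S0.
have [r0|] := eqVneq (\sum_(i <- r) s i) 0.
  have -> : \sum_(i <- r) s i *: z i = 0.
    elim: r {IH S0} r0 => [|b r IH]; rewrite ?big_nil// !big_cons => /eqP.
    rewrite paddr_eq0 ?sumr_ge0// => /andP[/eqP -> /eqP/IH ->].
    by rewrite scale0r addr0.
  move: S0; rewrite r0 !addr0 => S0.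
  by rewrite scalerA mulVf ?scale1r// lt0r_neq0.
rewrite neq_lt ltNge sumr_ge0//= => r0.
have := convex_setP cX (Xz a) (IH r0) (l := s a / (s a + \sum_(i <- r) s i)).
have -> : 1 - s a / (s a + \sum_(i <- r) s i) =
    (s a + \sum_(i <- r) s i)^-1 * \sum_(i <- r) s i.
  by field; rewrite lt0r_neq0.
rewrite scalerA mulfK ?lt0r_neq0// (mulrC (s a)) -scalerA -scalerDr.
apply; rewrite mulrC divr_ge0 ?(ltW S0)//= ler_pdivrMr// mul1r lerDl.
exact: ltW.
Qed.

Lemma convex_set_sum (I : finType) (X : set 'cV[R]_d) (s : I -> R)
    (z : I -> 'cV[R]_d) :
  convex_set X -> (forall i, 0 <= s i) -> \sum_i s i = 1 -> (forall i, X (z i)) ->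
  X (\sum_i s i *: z i).
Proof.
move=> cX s0 s1 Xz; have := convex_set_barycenter (r := index_enum I) cX s0 Xz.
by rewrite s1 invr1 scale1r; apply; rewrite ltr01.
Qed.

End Gradient.

(** * Bregman divergences and the mirror step *)

Section Bregman.
Context (R : realType) (d : nat) (N : 'cV[R]_d -> R) (hN : is_norm N).
Context (phi : 'cV[R]_d -> R) (X : set 'cV[R]_d) (rho : R).
Hypothesis phi_diff : forall x, differentiable (phi : 'cV[R]_d -> R^o) x.
Hypothesis cX : convex_set X.
Hypothesis phi_conv : strongly_convex_on N rho X phi.
Hypothesis rho0 : 0 < rho.
Implicit Types u v x z g : 'cV[R]_d.

Lemma bregman_refl u : bregman phi u u = 0.
Proof. by rewrite /bregman !subrr dotv0r subr0. Qed.

(** Along the segment from [v] to [u], strong convexity bounds the increment of [phi] by [l * (phi u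
    - phi v - rho / 2 * N (u - v) ^+ 2)] plus a term in [l ^+ 2]; the linear part passes to the
    gradient. *)
Lemma bregman_ge u v : X u -> X v -> rho / 2 * N (u - v) ^+ 2 <= bregman phi u v.
Proof.
move=> Xu Xv; rewrite lerBrDl -lerBrDr.
apply: (@dotv_grad_le _ _ _ _ _ _ (rho / 2 * N (u - v) ^+ 2)) => // l /andP[l0 l1].
have := phi_conv (l := l) Xu Xv; rewrite (ltW l0) l1 => /(_ isT).
have -> : v + l *: (u - v) = l *: u + (1 - l) *: v.
  by rewrite scalerBr scalerBl scale1r addrCA addrA.
lra.
Qed.

Lemma bregman_three_point u x v :
  bregman phi u x - bregman phi u v - bregman phi v x =
  dotv (grad phi v - grad phi x) (u - v).
Proof. rewrite /bregman dotvBl !dotvBr; ring. Qed.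

(** Variational inequality of the Bregman projection: minimality of [v] is tested along the segment
    towards [u]. *)
Lemma bregman_projection_le z v u : X v ->
  (forall u, X u -> bregman phi v z <= bregman phi u z) -> X u ->
  0 <= dotv (grad phi v - grad phi z) (u - v).
Proof.
move=> Xv vmin Xu; rewrite dotvBl subr_ge0.
apply: (@dotv_grad_ge _ _ _ _ _ _ 0) => // l /andP[l0 l1].
have /vmin : X (l *: u + (1 - l) *: v) by apply: convex_setP; rewrite ?(ltW l0).
have -> : l *: u + (1 - l) *: v = v + l *: (u - v).
  by rewrite scalerBr scalerBl scale1r addrCA addrA.
rewrite /bregman !(dotvBr, dotvDr, dotvZr); lra.
Qed.

Section MirrorStep.
Variables (a : R) (x z v g : 'cV[R]_d).
Hypothesis a0 : 0 < a.
Hypothesis Xx : X x.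
Hypothesis Xv : X v.
Hypothesis z_step : grad phi z = grad phi x - a *: g.
Hypothesis v_proj : forall u, X u -> bregman phi v z <= bregman phi u z.

Lemma mirror_step_three_point u : X u ->
  a * dotv g (v - u) <= bregman phi u x - bregman phi u v - bregman phi v x.
Proof.
move=> Xu; have := bregman_projection_le Xv v_proj Xu.
rewrite bregman_three_point z_step !dotvBl dotvZl -(opprB u v) dotvNr; lra.
Qed.

(** Take [u = x] in the three-point inequality: the divergences between [x] and [v] in both orders
    add up to at least [rho * N (v - x) ^+ 2], and one factor [N (v - x)] cancels. *)
Lemma mirror_step_length : N (v - x) <= a / rho * dual_norm N g.
Proof.
have h1 := mirror_step_three_point Xx.
have h2 := bregman_ge Xx Xv; have h3 := bregman_ge Xv Xx.
have h4 := dotv_le_dual hN g (x - v).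
rewrite bregman_refl in h1; rewrite !(is_norm_distC hN x) in h2 h4.
rewrite -(opprB v x) dotvNr in h4.
have [v0|v0] := eqVneq (N (v - x)) 0.
  by rewrite v0 mulr_ge0 ?dual_norm_ge0// divr_ge0// ltW.
have Nv0 : 0 < N (v - x) by rewrite lt_neqAle eq_sym v0 is_norm_ge0.
rewrite mulrAC ler_pdivlMr// -(ler_pM2r Nv0).
have := ler_wpM2l (ltW a0) h4; lra.
Qed.

(** Split [x - u] at [v]. The part [v - u] is the three-point inequality, whose term
    [- bregman phi v x] pays for the part [x - v]. *)
Lemma mirror_step_regret u : X u ->
  dotv g (x - u) <= a^-1 * (bregman phi u x - bregman phi u v)
                    + a / (2 * rho) * dual_norm N g ^+ 2.
Proof.
move=> Xu; have h1 := mirror_step_three_point Xu.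
have h2 := bregman_ge Xv Xx.
have h3 := dotv_le_dual hN g (x - v).
rewrite (is_norm_distC hN) in h3.
have -> : x - u = (x - v) + (v - u) by rewrite addrA subrK.
rewrite dotvDr.
(* AM-GM: a |g| N <= rho N^2 / 2 + a^2 |g|^2 / (2 rho) *)
have h4 : a * (dual_norm N g * N (v - x)) <=
    rho / 2 * N (v - x) ^+ 2 + a ^+ 2 / (2 * rho) * dual_norm N g ^+ 2.
  rewrite -subr_ge0.
  have -> : rho / 2 * N (v - x) ^+ 2 + a ^+ 2 / (2 * rho) * dual_norm N g ^+ 2
    - a * (dual_norm N g * N (v - x)) =
      (rho * N (v - x) - a * dual_norm N g) ^+ 2 / (2 * rho).
    by field; rewrite lt0r_neq0.
  by rewrite divr_ge0 ?sqr_ge0// mulr_ge0// ltW.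
rewrite -(ler_pM2l a0) mulrDr.
have -> : a * (a^-1 * (bregman phi u x - bregman phi u v) +
    a / (2 * rho) * dual_norm N g ^+ 2) =
  bregman phi u x - bregman phi u v + a ^+ 2 / (2 * rho) * dual_norm N g ^+ 2.
  by field; rewrite !lt0r_neq0.
have := ler_wpM2l (ltW a0) h3; lra.
Qed.

End MirrorStep.
End Bregman.

(** * Contraction by doubly stochastic matrices *)

Section SumsOfSquares.
Context (R : realType).

(** Twice the variance of [y] under the weights [a], as a mean over pairs. *)
Lemma sum_weighted_sqr_dist (I : finType) (a y : I -> R) : \sum_i a i = 1 ->
  \sum_i \sum_j a i * a j * (y i - y j) ^+ 2 =
  2 * (\sum_i a i * y i ^+ 2 - (\sum_i a i * y i) ^+ 2).
Proof.
move=> a1.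
have -> : \sum_i \sum_j a i * a j * (y i - y j) ^+ 2 =
   \sum_i (a i * y i ^+ 2 + a i * (\sum_j a j * y j ^+ 2)
           - 2 * (a i * y i) * (\sum_j a j * y j)).
  apply: eq_bigr => i _.
  have -> : a i * y i ^+ 2 = \sum_j a i * y i ^+ 2 * a j.
    by rewrite -mulr_sumr a1 mulr1.
  rewrite !mulr_sumr -!big_split/= -sumrB.
  by apply: eq_bigr => j _; ring.
rewrite sumrB big_split/= -!mulr_suml -!mulr_sumr a1; ring.
Qed.

(** Squares of nonnegative increments are superadditive; the induction also carries
    [u p <= u (p + m)], which makes the cross term nonnegative. *)
Lemma sum_sqr_gaps_le (u : nat -> R) (p m : nat) :
  (forall d, (p <= d < p + m)%N -> u d <= u d.+1) ->
  \sum_(p <= d < p + m) (u d.+1 - u d) ^+ 2 <= (u (p + m)%N - u p) ^+ 2.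
Proof.
move=> mono.
suff [] : u p <= u (p + m)%N /\
  \sum_(p <= d < p + m) (u d.+1 - u d) ^+ 2 <= (u (p + m)%N - u p) ^+ 2 by [].
elim: m mono => [|m IH] mono.
  by rewrite addn0 big_geq// subrr expr0n.
have [d /andP[pd dm]|le_p IHs] := IH.
  by apply: mono; rewrite pd addnS ltnS ltnW.
have le_m : u (p + m)%N <= u (p + m).+1 by apply: mono; rewrite leq_addr addnS /=.
rewrite addnS big_nat_recr ?leq_addr//=; split; first exact: le_trans le_m.
nra.
Qed.

(** Cauchy-Schwarz for the [m] increments. *)
Lemma sqr_dist_le_sum_gaps (u : nat -> R) (p m : nat) :
  (u (p + m)%N - u p) ^+ 2 <= m%:R * \sum_(p <= d < p + m) (u d.+1 - u d) ^+ 2.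
Proof.
elim: m => [|m IH]; first by rewrite addn0 subrr expr0n mul0r.
rewrite addnS big_nat_recr ?leq_addr//=.
have S0 : 0 <= \sum_(p <= i < p + m) (u i.+1 - u i) ^+ 2.
  by apply: sumr_ge0 => i _; exact: sqr_ge0.
move: IH S0; set S := \sum_(_ <= _ < _) _.
have -> : u (p + m).+1 - u p = (u (p + m)%N - u p) + (u (p + m).+1 - u (p + m)%N).
  by ring.
move: (u (p + m)%N - u p) (u (p + m).+1 - u (p + m)%N) => a b IH S0.
have [m0|m0] := eqVneq m 0%N; first by rewrite m0 mul0r in IH *; nra.
have m1 : 0 < m%:R :> R by rewrite ltr0n lt0n.
rewrite -(ler_pM2l m1) -natr1 -subr_ge0.
have := sqr_ge0 (a - m%:R * b).
have := ler_wpM2l (ltW m1) IH.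
nra.
Qed.

End SumsOfSquares.

Section Cut.
Context (n : nat) (E : rel 'I_n).

Lemma connect_crosses_cut (S : {set 'I_n}) i j : connect E i j ->
  i \in S -> j \notin S -> exists u v, [/\ u \in S, v \notin S & E u v].
Proof.
case/connectP => p; elim: p i => [|k p IH] i /=; first by move=> _ -> ->.
case/andP=> Eik kp jE iS jS.
have [kS|kS] := boolP (k \in S); first exact: IH kp jE kS jS.
by exists i, k.
Qed.

End Cut.

Section Contraction.
Context (R : realType) (n : nat) (E : rel 'I_n) (A : 'M[R]_n) (zeta : R).
Hypothesis zeta01 : 0 < zeta < 1.
Hypothesis A_stoch : doubly_stochastic A.
Hypothesis A_weight : forall i j,
  (j \in in_nbhd E i -> zeta < A i j) /\ (j \notin in_nbhd E i -> A i j = 0).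
Hypothesis E_conn : strongly_connected E.

(** Some [v] outside [S] hears some [u] in [S], and also itself. Row [v] thus puts more than [zeta]
    on each side of the cut, and the larger of its two shares is at least 1/2. *)
Lemma cut_weight_ge (S : {set 'I_n}) i j : i \in S -> j \notin S ->
  zeta / 2 <= \sum_k (\sum_(u in S) A k u) * (\sum_(u in ~: S) A k u).
Proof.
move=> iS jS; have [A0 A1 _] := A_stoch.
have [u [v [uS vS Euv]]] := connect_crosses_cut (E_conn i j) iS jS.
have zv : zeta < A v v by apply: (A_weight v v).1; rewrite inE eqxx.
have zu : zeta < A v u by apply: (A_weight v u).1; rewrite inE Euv orbT.
rewrite (bigD1 v)//=.
have rest : 0 <= \sum_(k | k != v) (\sum_(u in S) A k u) * (\sum_(u in ~: S) A k u).
  by apply: sumr_ge0 => k _; rewrite mulr_ge0 ?sumr_ge0.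
have a1 : \sum_(u in S) A v u + \sum_(u in ~: S) A v u = 1.
  rewrite -(A1 v) [RHS](bigID (mem S))/=; congr (_ + _).
  by apply: eq_bigl => k; rewrite inE.
have au : zeta < \sum_(u in S) A v u.
  rewrite (bigD1 u)//=; apply: lt_le_trans zu _.
  by rewrite lerDl sumr_ge0.
have av : zeta < \sum_(u in ~: S) A v u.
  rewrite (bigD1 v)/= ?inE//; apply: lt_le_trans zv _.
  by rewrite lerDl sumr_ge0.
apply: le_trans (_ : (\sum_(u in S) A v u) * (\sum_(u in ~: S) A v u) <= _); last first.
  by rewrite lerDl.
case/andP: zeta01 => z0 z1.
move: a1 au av; move: (\sum_(u in S) A v u) (\sum_(u in ~: S) A v u) => a b a1 au av.
have -> : b = 1 - a by lra.
have [ha|ha] := leP a (1 / 2); nra.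
Qed.

Section SortedValues.
Variable y : 'cV[R]_n.

(** [u p] is the p-th smallest value. Ties share the index of their first occurrence, so [S d] is
    the sublevel set of [u d]; its complement can be empty, but only when the gap [g d] is 0. *)
Let s := sort <=%R [seq y i 0 | i <- enum 'I_n].
Let u p := nth 0 s p.
Let rank i := index (y i 0) s.
Let g d := u d.+1 - u d.
Let S d : {set 'I_n} := [set i | (rank i <= d)%N].

Let size_s : size s = n.
Proof. by rewrite size_sort size_map size_enum_ord. Qed.

Let mem_s i : y i 0 \in s.
Proof. by rewrite mem_sort; apply: map_f; rewrite mem_enum. Qed.

Let rank_lt i : (rank i < n)%N.
Proof. by rewrite -size_s index_mem. Qed.

Let u_rank i : u (rank i) = y i 0.
Proof. exact: nth_index (mem_s i). Qed.

Let u_mono p q : (p <= q < n)%N -> u p <= u q.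
Proof.
case/andP=> pq qn; apply: (sorted_leq_nth le_trans lexx) => //.
- exact/sort_sorted/le_total.
- by rewrite inE size_s (leq_ltn_trans pq).
- by rewrite inE size_s.
Qed.

Let u_surj p : (p < n)%N -> exists i, y i 0 = u p.
Proof.
move=> pn; have := @mem_nth _ 0 s p; rewrite size_s => /(_ pn).
by rewrite mem_sort => /mapP[i _ yi]; exists i; rewrite -yi.
Qed.

(** The cuts with [i] below and [j] above are those with [rank i <= d < rank j], and their gaps add
    up to the distance of the two values. *)
Let sum_gaps_le_dist i j : (rank i <= rank j)%N ->
  \sum_(0 <= d < n.-1) g d ^+ 2 * ((i \in S d) && (j \notin S d))%:R
  <= (y i 0 - y j 0) ^+ 2.
Proof.
move=> ij; rewrite -(u_rank i) -(u_rank j).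
have jn : (rank j <= n.-1)%N by rewrite -ltnS (ltn_predK (rank_lt j)) rank_lt.
have -> : \sum_(0 <= d < n.-1) g d ^+ 2 * ((i \in S d) && (j \notin S d))%:R =
    \sum_(rank i <= d < rank j) g d ^+ 2.
  rewrite (big_cat_nat (n := rank i)) ?(leq_trans ij)//= big_nat_cond big1 ?add0r; last first.
    by move=> d /andP[/andP[_ di] _]; rewrite !inE [(rank i <= d)%N]leqNgt di mulr0.
  rewrite (big_cat_nat (n := rank j))//= [X in _ + X]big_nat_cond [X in _ + X]big1 ?addr0; last first.
    by move=> d /andP[/andP[jd _] _]; rewrite !inE jd andbF mulr0.
  rewrite big_nat_cond [RHS]big_nat_cond; apply: eq_bigr => d.
  by case/andP=> /andP[di dj] _; rewrite !inE di -ltnNge dj mulr1.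
have := sum_sqr_gaps_le (u := u) (p := rank i) (m := (rank j - rank i)%N).
rewrite subnKC// -[(u (rank i) - _) ^+ 2]sqrrN opprB; apply => d /andP[_ dj].
by apply: u_mono; rewrite leqnSn (leq_ltn_trans dj).
Qed.

Let sum_gaps_le_dist2 i j :
  \sum_(0 <= d < n.-1) g d ^+ 2 * (((i \in S d) && (j \notin S d))%:R
     + ((j \in S d) && (i \notin S d))%:R) <= (y i 0 - y j 0) ^+ 2.
Proof.
wlog ij : i j / (rank i <= rank j)%N => [hw|].
  have [|/ltnW] := leqP (rank i) (rank j); first exact: hw.
  move=> /hw; rewrite -[(y j 0 - _) ^+ 2]sqrrN opprB.
  by apply: le_trans; rewrite le_eqVlt; apply/orP; left; apply/eqP;
     apply: eq_bigr => d _; rewrite addrC.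
apply: le_trans (sum_gaps_le_dist ij).
rewrite le_eqVlt; apply/orP; left; apply/eqP.
apply: eq_bigr => d _; congr (_ * _).
rewrite !inE; have [jd|] := boolP (rank j <= d)%N; last by rewrite addr0.
by rewrite (leq_trans ij jd) addr0.
Qed.

(** Bound every squared distance by the gaps it crosses and exchange the sums: cut [d] collects the
    product of the weights of its two sides twice, once for each order of the pair. *)
Let row_dispersion_ge (a : 'I_n -> R) : (forall i, 0 <= a i) ->
  \sum_(0 <= d < n.-1) g d ^+ 2 *
    (2 * ((\sum_(i in S d) a i) * (\sum_(i in ~: S d) a i)))
  <= \sum_i \sum_j a i * a j * (y i 0 - y j 0) ^+ 2.
Proof.
move=> a0; apply: le_trans (_ : \sum_i \sum_j a i * a j *
   \sum_(0 <= d < n.-1) g d ^+ 2 * (((i \in S d) && (j \notin S d))%:R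
     + ((j \in S d) && (i \notin S d))%:R) <= _); last first.
  apply: ler_sum => i _; apply: ler_sum => j _.
  by rewrite ler_wpM2l ?mulr_ge0// sum_gaps_le_dist2.
under [leRHS]eq_bigr do (under eq_bigr do rewrite mulr_sumr; rewrite exchange_big/=).
rewrite exchange_big/= le_eqVlt; apply/orP; left; apply/eqP.
apply: eq_bigr => d _.
have -> : \sum_(i in S d) a i = \sum_i a i * (i \in S d)%:R.
  by rewrite big_mkcond/=; apply: eq_bigr => i _; case: ifP; rewrite ?mulr1 ?mulr0.
have -> : \sum_(i in ~: S d) a i = \sum_i a i * (i \notin S d)%:R.
  rewrite big_mkcond/=; apply: eq_bigr => i _.
  by rewrite finset.in_setC; case: (i \in S d); rewrite ?mulr1 ?mulr0.
have double (p q : R) : 2 * (p * q) = p * q + q * p by ring.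
rewrite double !mulr_suml -big_split/= mulr_sumr.
apply: eq_bigr => i _; rewrite !mulr_sumr -big_split/= mulr_sumr.
by apply: eq_bigr => j _; rewrite -!mulnb !natrM; ring.
Qed.

(* Averaging destroys at least the dispersion across the cuts {rank <= d},
   each of which carries a weight at least zeta / 2. *)
Let sum_sqr_mix_le :
  \sum_k (A *m y) k 0 ^+ 2 <=
  \sum_i y i 0 ^+ 2 - zeta / 2 * \sum_(0 <= d < n.-1) g d ^+ 2.
Proof.
have [A0 A1 A2] := A_stoch.
(* Half the dispersion of row [k] is the loss in Jensen's inequality; the unit column sums then
   restore the full sum of squares. *)
have row k : (A *m y) k 0 ^+ 2 =
   \sum_i A k i * y i 0 ^+ 2 - 2^-1 * \sum_i \sum_j A k i * A k j * (y i 0 - y j 0) ^+ 2.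
  by rewrite (sum_weighted_sqr_dist (fun i => y i 0) (A1 k)) mxE; field.
rewrite (eq_bigr _ (fun k _ => row k)) sumrB.
have -> : \sum_k \sum_i A k i * y i 0 ^+ 2 = \sum_i y i 0 ^+ 2.
  by rewrite exchange_big/=; apply: eq_bigr => i _; rewrite -mulr_suml A2 mul1r.
rewrite lerD2l lerN2 -mulr_sumr.
apply: le_trans (_ : 2^-1 * \sum_k \sum_(0 <= d < n.-1) g d ^+ 2 *
    (2 * ((\sum_(i in S d) A k i) * (\sum_(i in ~: S d) A k i))) <= _); last first.
  by rewrite ler_wpM2l ?invr_ge0//; apply: ler_sum => k _; exact: row_dispersion_ge.
rewrite exchange_big/= !mulr_sumr big_nat_cond [leRHS]big_nat_cond.
apply: ler_sum => d; rewrite andbT => /andP[_ dn].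
(* A zero gap contributes nothing, and its cut may have an empty side. *)
have [->|g0] := eqVneq (g d) 0.
  by rewrite expr0n/= mulr0 big1 ?mulr0// => k _; rewrite mul0r.
rewrite -mulr_sumr [leLHS]mulrC [leRHS]mulrCA ler_wpM2l ?sqr_ge0// -mulr_sumr mulrA mulVf ?pnatr_eq0// mul1r.
have dn1 : (d.+1 < n)%N by rewrite -ltn_predRL.
(* The smallest value lies in [S d]; a holder of the value [u d.+1] lies outside, as the gap is not
   0. *)
have [i yi] : exists i, y i 0 = u 0 by apply: u_surj; exact: leq_ltn_trans dn1.
have [j yj] := u_surj dn1.
apply: (@cut_weight_ge _ i j); rewrite inE.
  rewrite /rank yi; suff -> : index (u 0) s = 0%N by [].
  by rewrite /u /s; case: (sort _ _) => //= x l; rewrite eqxx.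
apply: contra g0 => jd; rewrite /g subr_eq0 eq_le; apply/andP; split.
  by rewrite -yj -u_rank u_mono// jd ltnW.
by rewrite u_mono// leqnSn dn1.
Qed.

(** With mean 0, the value 0 lies between the extremes, so each [|y i|] is at most the range. One
    factor [n] comes from Cauchy-Schwarz on the gaps, the other counts the agents. *)
Let sum_sqr_le_gaps : \sum_i y i 0 = 0 ->
  \sum_i y i 0 ^+ 2 <= n%:R ^+ 2 * \sum_(0 <= d < n.-1) g d ^+ 2.
Proof.
move=> y0; have [n0|n0] := posnP n.
  rewrite big1 ?mulr_ge0 ?sqr_ge0 ?sumr_ge0// => [d _|i _]; first exact: sqr_ge0.
  by have := ltn_ord i; rewrite [X in (_ < X)%N]n0.
have range i : u 0 <= y i 0 <= u n.-1.
  rewrite -(u_rank i) !u_mono//.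
    by rewrite -ltnS prednK ?rank_lt//= prednK.
  by rewrite leq0n rank_lt.
have n1 : 0 < n%:R :> R by rewrite ltr0n.
have sum_const (b : R) : n%:R * b = \sum_(i < n) b.
  by rewrite sumr_const card_ord mulr_natl.
have u0 : u 0 <= 0.
  rewrite -(ler_pM2l n1) mulr0 -y0 sum_const.
  by apply: ler_sum => i _; case/andP: (range i).
have un : 0 <= u n.-1.
  rewrite -(ler_pM2l n1) mulr0 -y0 sum_const.
  by apply: ler_sum => i _; case/andP: (range i).
have le_gaps : (u n.-1 - u 0) ^+ 2 <= n%:R * \sum_(0 <= d < n.-1) g d ^+ 2.
  apply: le_trans (sqr_dist_le_sum_gaps u 0 n.-1) _.
  by rewrite ler_wpM2r ?ler_nat ?leq_pred// sumr_ge0// => d _; exact: sqr_ge0.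
rewrite expr2 -mulrA.
apply: le_trans (_ : n%:R * (u n.-1 - u 0) ^+ 2 <= _); last by rewrite ler_pM2l.
rewrite sum_const; apply: ler_sum => i _.
case/andP: (range i); nra.
Qed.

(** The loss, [zeta / 2] times the squared gaps, is at least [c] times the sum of squares for
    [c = zeta / (2 n^2)]; then [1 - c <= (1 - c / 2)^2]. *)
Lemma sum_sqr_mix_contract : \sum_i y i 0 = 0 ->
  \sum_k (A *m y) k 0 ^+ 2 <=
  (1 - zeta / (4 * n%:R ^+ 2)) ^+ 2 * \sum_i y i 0 ^+ 2.
Proof.
move=> y0; have h1 := sum_sqr_mix_le; have h2 := sum_sqr_le_gaps y0.
have [n0|n0] := posnP n.
  rewrite !big1 ?mulr0// => i _; by have := ltn_ord i; rewrite [X in (_ < X)%N]n0.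
have n1 : 0 < n%:R ^+ 2 :> R by rewrite exprn_gt0// ltr0n.
case/andP: zeta01 => z0 _; apply: le_trans h1 _.
move: h2; set V := \sum_i y i 0 ^+ 2; set G := \sum_(_ <= _ < _) _ => h2.
have S0 : 0 <= V by apply: sumr_ge0 => i _; exact: sqr_ge0.
have h3 : zeta / (2 * n%:R ^+ 2) * V <= zeta / 2 * G.
  have d0 : 0 < 2 * n%:R ^+ 2 :> R by exact: mulr_gt0.
  rewrite mulrAC ler_pdivrMr//.
  have := ler_wpM2l (ltW z0) h2; lra.
have -> : zeta / (4 * n%:R ^+ 2) = (zeta / (2 * n%:R ^+ 2)) / 2.
  by field; rewrite lt0r_neq0// ltr0n.
set c := zeta / (2 * n%:R ^+ 2) in h3 *.
have := mulr_ge0 (sqr_ge0 (c / 2)) S0; lra.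
Qed.

End SortedValues.
End Contraction.

(** * Products of weight matrices and deviation from the average *)

Section Mixing.
Context (R : realType) (n : nat) (sigma : R).
Hypothesis sigma01 : 0 <= sigma <= 1.

(* A product of q weight matrices of connected graphs. *)
Record mixing (q : nat) (Phi : 'M[R]_n) : Prop := Mixing {
  mixing_row : forall i, \sum_j Phi i j = 1;
  mixing_col : forall j, \sum_i Phi i j = 1;
  mixing_contract : forall y : 'cV[R]_n, \sum_i y i 0 = 0 ->
    \sum_k (Phi *m y) k 0 ^+ 2 <= (sigma ^+ q) ^+ 2 * \sum_i y i 0 ^+ 2
}.

Lemma mixing1 : mixing 0 1%:M.
Proof.
split=> [i|j|y _]; last by rewrite mul1mx expr0 expr1n mul1r.
  rewrite (bigD1 i)//= big1 ?mxE ?eqxx ?addr0// => j ji.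
  by rewrite mxE eq_sym (negbTE ji).
rewrite (bigD1 j)//= big1 ?mxE ?eqxx ?addr0// => i ij.
by rewrite mxE (negbTE ij).
Qed.

Lemma mixingW p q Phi : (p <= q)%N -> mixing q Phi -> mixing p Phi.
Proof.
move=> pq [hr hc hy]; split=> // y /hy h; apply: le_trans h _.
case/andP: sigma01 => s0 s1.
rewrite ler_wpM2r ?sumr_ge0// => [i _|]; first exact: sqr_ge0.
by rewrite lerXn2r ?nnegrE ?exprn_ge0// ler_wiXn2l.
Qed.

Lemma sum_mulmx_col (Phi : 'M[R]_n) (y : 'cV[R]_n) :
  (forall j, \sum_i Phi i j = 1) -> \sum_k (Phi *m y) k 0 = \sum_i y i 0.
Proof.
move=> h; under eq_bigr do rewrite mxE.
by rewrite exchange_big/=; apply: eq_bigr => i _; rewrite -mulr_suml h mul1r.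
Qed.

Lemma mixing_mulmx p q Phi Psi : mixing p Phi -> mixing q Psi ->
  mixing (p + q) (Phi *m Psi).
Proof.
move=> [r1 c1 h1] [r2 c2 h2]; split => [i|j|y y0].
- under eq_bigr do rewrite mxE.
  rewrite exchange_big/= -[RHS](r1 i); apply: eq_bigr => k _.
  by rewrite -mulr_sumr r2 mulr1.
- under eq_bigr do rewrite mxE.
  rewrite exchange_big/= -[RHS](c2 j); apply: eq_bigr => k _.
  by rewrite -mulr_suml c1 mul1r.
- rewrite -mulmxA; apply: le_trans (h1 _ _) _; first by rewrite sum_mulmx_col.
  have -> : (sigma ^+ (p + q)) ^+ 2 * \sum_i y i 0 ^+ 2 =
    (sigma ^+ p) ^+ 2 * ((sigma ^+ q) ^+ 2 * \sum_i y i 0 ^+ 2) by rewrite exprD; ring.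
  by rewrite ler_wpM2l ?sqr_ge0// h2.
Qed.

(** Apply the contraction to the j-th basis vector minus its mean: its sum of squares is [1 - 1/n],
    and entry [i] of its image is [Phi i j - 1/n]. *)
Lemma mixing_entry q Phi i j : mixing q Phi -> `|Phi i j - n%:R^-1| <= sigma ^+ q.
Proof.
move=> [hr hc hy].
have n0 : n%:R != 0 :> R by rewrite pnatr_eq0 -lt0n (leq_ltn_trans _ (ltn_ord i)).
have n1 : 0 < n%:R^-1 :> R by rewrite invr_gt0 ltr0n (leq_ltn_trans _ (ltn_ord i)).
pose y : 'cV[R]_n := \col_k ((k == j)%:R - n%:R^-1).
have yj : \sum_k (k == j)%:R = 1 :> R.
  by rewrite (bigD1 j)//= eqxx big1 ?addr0// => k /negbTE ->.
have y0 : \sum_k y k 0 = 0.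
  under eq_bigr do rewrite mxE.
  by rewrite sumrB yj sumr_const card_ord -(mulr_natl n%:R^-1) mulfV ?subrr.
have yy : \sum_k y k 0 ^+ 2 <= 1.
  have -> : \sum_k y k 0 ^+ 2 = \sum_k ((k == j)%:R * (1 - n%:R^-1) - n%:R^-1 * y k 0).
    apply: eq_bigr => k _; rewrite mxE; case: eqP => _ /=; ring.
  by rewrite sumrB -mulr_suml -mulr_sumr y0 mulr0 subr0 yj mul1r gerBl ltW.
have Py : (Phi *m y) i 0 = Phi i j - n%:R^-1.
  rewrite mxE; under eq_bigr do rewrite mxE mulrBr.
  rewrite sumrB -mulr_suml hr mul1r; congr (_ - _).
  rewrite (bigD1 j)//= eqxx mulr1 big1 ?addr0// => k /negbTE ->.
  by rewrite mulr0.
rewrite -Py -ler_sqr ?nnegrE// ?exprn_ge0//; last by case/andP: sigma01.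
rewrite real_normK ?num_real//.
apply: le_trans (_ : \sum_k (Phi *m y) k 0 ^+ 2 <= _).
  by rewrite (bigD1 i)//= lerDl sumr_ge0// => k _; exact: sqr_ge0.
apply: le_trans (hy _ y0) _.
by rewrite ler_piMr ?sqr_ge0.
Qed.

Section Spread.
Context (d : nat) (N : 'cV[R]_d -> R) (hN : is_norm N).
Implicit Types Z : 'I_n -> 'cV[R]_d.

(** Points obtained by mixing of strength [q] from sources of total norm at most [c]. Matrix and
    sources stay hidden: averaging raises [q], nonexpansive prediction keeps both parameters, and
    the deviation depends on them alone. *)
Definition spread (q : nat) (c : R) Z := exists Phi v,
  [/\ mixing q Phi, forall i, Z i = \sum_j Phi i j *: v j & \sum_j N (v j) <= c].

Lemma spread0 Z : spread 0 (\sum_j N (Z j)) Z.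
Proof.
exists 1%:M, Z; split => [|i|//]; first exact: mixing1.
rewrite (bigD1 i)//= mxE eqxx scale1r big1 ?addr0// => j ji.
by rewrite mxE eq_sym (negbTE ji) scale0r.
Qed.

Lemma spreadW p q c Z : (p <= q)%N -> spread q c Z -> spread p c Z.
Proof. by move=> pq [Phi [v [h1 h2 h3]]]; exists Phi, v; split=> //; exact: mixingW h1. Qed.

Lemma spread_mix p q c (M : 'M[R]_n) Z : mixing p M -> spread q c Z ->
  spread (p + q) c (fun i => \sum_j M i j *: Z j).
Proof.
move=> hM [Phi [v [h1 h2 h3]]]; exists (M *m Phi), v; split => //.
  exact: mixing_mulmx.
move=> i; under eq_bigr do rewrite h2 scaler_sumr.
rewrite exchange_big/=; apply: eq_bigr => j _; rewrite mxE scaler_suml.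
by apply: eq_bigr => k _; rewrite scalerA.
Qed.

(** [B] acts on coordinates and averaging on agents, so the two commute. *)
Lemma spread_linear q c (B : 'M[R]_d) Z : (forall u, N (B *m u) <= N u) ->
  spread q c Z -> spread q c (fun i => B *m Z i).
Proof.
move=> hB [Phi [v [h1 h2 h3]]]; exists Phi, (fun j => B *m v j); split => //.
  by move=> i; rewrite h2 mulmx_sumr; apply: eq_bigr => j _; rewrite scalemxAr.
by apply: le_trans h3; apply: ler_sum => j _; exact: hB.
Qed.

Lemma average_mixing q Phi (v : 'I_n -> 'cV[R]_d) : mixing q Phi ->
  average (fun i => \sum_j Phi i j *: v j) = average v.
Proof.
move=> [_ hc _]; congr (_ *: _); rewrite exchange_big/=.
by apply: eq_bigr => j _; rewrite -scaler_suml hc scale1r.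
Qed.

(** Mixing preserves the average, so the deviation of agent [i] is the sum of the
    [(Phi i j - 1/n) *: v j]. *)
Lemma spread_deviation q c Z i : spread q c Z ->
  N (Z i - average Z) <= sigma ^+ q * c.
Proof.
move=> [Phi [v [h1 h2 h3]]].
have -> : Z = (fun i => \sum_j Phi i j *: v j) by apply/funext.
rewrite (average_mixing _ h1) /average scaler_sumr -sumrB.
apply: le_trans (is_norm_sum hN _ _ _) _.
apply: le_trans (_ : \sum_j sigma ^+ q * N (v j) <= _).
  apply: ler_sum => j _; rewrite -scalerBl (is_norm_homog hN).
  by rewrite ler_wpM2r ?is_norm_ge0// (mixing_entry _ _ h1).
rewrite -mulr_sumr ler_wpM2l// exprn_ge0//.
by case/andP: sigma01.
Qed.

Lemma average_sum (I : Type) (r : seq I) (Y : I -> 'I_n -> 'cV[R]_d) :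
  average (fun i => \sum_(s <- r) Y s i) = \sum_(s <- r) average (Y s).
Proof. by rewrite /average -scaler_sumr exchange_big. Qed.

End Spread.
End Mixing.

Lemma geometric_sum_le (R : realType) (r : R) (m : nat) : 0 <= r < 1 ->
  \sum_(0 <= k < m) r ^+ k.+1 <= r / (1 - r).
Proof.
case/andP=> r0 r1; rewrite ler_pdivlMr ?subr_gt0//.
suff -> : (\sum_(0 <= k < m) r ^+ k.+1) * (1 - r) = r - r ^+ m.+1.
  by rewrite gerBl exprn_ge0.
elim: m => [|m IH]; first by rewrite big_geq// expr1; ring.
by rewrite big_nat_recr//= mulrDl IH !exprS; ring.
Qed.

Lemma mixing_weight_matrix (R : realType) (n : nat) (E : rel 'I_n) (A : 'M[R]_n)
    (zeta : R) : 0 < zeta < 1 -> doubly_stochastic A ->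
  (forall i j, (j \in in_nbhd E i -> zeta < A i j) /\
               (j \notin in_nbhd E i -> A i j = 0)) ->
  strongly_connected E -> mixing (1 - zeta / (4 * n%:R ^+ 2)) 1 A.
Proof.
move=> z01 hA hw hE; have [_ hr hc] := hA; split => // y y0.
by rewrite expr1; exact: sum_sqr_mix_contract hw hE y y0.
Qed.

(** * Saddle point gap *)

Section SaddleGap.
Context (R : realType) (n d m : nat).
Context (Nx : 'cV[R]_d -> R) (Ny : 'cV[R]_m -> R).
Context (X : set 'cV[R]_d) (Y : set 'cV[R]_m) (LX LY : R).
Context (F : 'I_n -> 'cV[R]_d -> 'cV[R]_m -> R).
Context (x : 'I_n -> 'cV[R]_d) (y : 'I_n -> 'cV[R]_m).
Context (xb xs : 'cV[R]_d) (yb ys : 'cV[R]_m) (q : 'I_n -> R).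
Hypothesis hNx : is_norm Nx.
Hypothesis hNy : is_norm Ny.
Hypotheses (LX0 : 0 <= LX) (LY0 : 0 <= LY).
Hypothesis F_lipx : forall i u u' v, X u -> X u' -> Y v ->
  F i u v - F i u' v <= LX * Nx (u - u').
Hypothesis F_lipy : forall i u v v', X u -> Y v -> Y v' ->
  F i u v - F i u v' <= LY * Ny (v - v').
Hypotheses (Xx : forall i, X (x i)) (Yy : forall i, Y (y i)).
Hypotheses (Xxb : X xb) (Yyb : Y yb) (Xxs : X xs).
Hypothesis F_saddle : \sum_i F i xs yb <= \sum_i F i xs ys.
Hypothesis F_descent : forall i, F i (x i) (y i) - F i xs (y i) <= q i.

(** The saddle inequality needs one common [y], hence the average [yb]. For each [i], move from
    [(x j, y j)] to [(xb, yb)], then to [(x i, y i)], descend to [(xs, y i)], and move to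
    [(xs, yb)]. The first move costs [a j] for each of the [n] functions, the others at most
    [2 * a i]: this is the factor [n + 2]. *)
Lemma saddle_gap_le j :
  \sum_i F i (x j) (y j) - \sum_i F i xs ys <=
  (n%:R + 2) * \sum_i (LX * Nx (x i - xb) + LY * Ny (y i - yb)) + \sum_i q i.
Proof.
pose a i := LX * Nx (x i - xb) + LY * Ny (y i - yb).
have a0 i : 0 <= a i.
  by rewrite addr_ge0// mulr_ge0// is_norm_ge0.
set A := \sum_i (_ + _); have aA : a j <= A.
  by rewrite /A (bigD1 j)//= lerDl; apply: sumr_ge0 => i _; exact: a0.
apply: le_trans (_ : \sum_i (a j + 2 * a i + q i) <= _).
  apply: le_trans (_ : \sum_i F i (x j) (y j) - \sum_i F i xs yb <= _).
    by rewrite lerD2l lerN2.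
  rewrite -sumrB; apply: ler_sum => i _.
  have h1 := F_lipx i (Xx j) Xxb (Yy j).
  have h2 := F_lipy i Xxb (Yy j) Yyb.
  have h3 := F_lipx i Xxb (Xx i) Yyb.
  have h4 := F_lipy i (Xx i) Yyb (Yy i).
  have h5 := F_lipy i Xxs (Yy i) Yyb.
  rewrite (is_norm_distC hNx) in h3; rewrite (is_norm_distC hNy) in h4.
  have h6 := F_descent i; have h7 := mulr_ge0 LX0 (is_norm_ge0 hNx (x i - xb)).
  rewrite /a; lra.
have aE : \sum_i a i = A by [].
rewrite big_split/= lerD2r big_split/= -mulr_sumr aE [(n%:R + 2) * A]mulrDl lerD2r.
by rewrite sumr_const card_ord -(mulr_natl (a j)) ler_wpM2l.
Qed.

End SaddleGap.

(** * Expectations *)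

Section Mean.
Context (dd : measure_display) (Om : measurableType dd) (R : realType).
Context (P : probability Om R).
Implicit Types (U V W B : Om -> R) (a b e k : R).
Import HBNNSimple.

(* The integral of a function is defined without measurability, as a difference
   of two suprema over simple functions, so it is always monotone. *)
Lemma le_integral_nonmeasurable (f g : Om -> \bar R) : (forall w, f w <= g w)%E ->
  (\int[P]_w f w <= \int[P]_w g w)%E.
Proof.
move=> fg; rewrite integralE [leRHS]integralE; apply: leeB.
  rewrite !ge0_integralTE; try by move=> w; rewrite ?funepos_ge0.
  apply: ereal_sup_le => _ [h /= hf <-]; exists h => //= w.
  by apply: le_trans (hf w) _; rewrite funepos.unlock ge_max !le_max fg lexx orbT.
rewrite !ge0_integralTE; try by move=> w; rewrite ?funeneg_ge0.
apply: ereal_sup_le => _ [h /= hf <-]; exists h => //= w.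
by apply: le_trans (hf w) _; rewrite funeneg.unlock ge_max !le_max leeN2 fg lexx orbT.
Qed.

(** Integrability is part of this predicate and of the next, so that both pass to sums without side
    conditions. *)
Definition mean_le U b :=
  P.-integrable setT (EFin \o U) /\ (\int[P]_w (U w)%:E <= b%:E)%E.

Definition same_mean U V :=
  [/\ P.-integrable setT (EFin \o U), P.-integrable setT (EFin \o V) &
      (\int[P]_w (U w)%:E = \int[P]_w (V w)%:E)%E].

Lemma integrable_addR U V : P.-integrable setT (EFin \o U) ->
  P.-integrable setT (EFin \o V) ->
  P.-integrable setT (EFin \o (fun w => U w + V w)).
Proof. by move=> iU iV; have := integrableD measurableT iU iV. Qed.

Lemma integrable_scaleR k U : P.-integrable setT (EFin \o U) ->
  P.-integrable setT (EFin \o (fun w => k * U w)).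
Proof. by move=> iU; have := integrableZl measurableT k iU. Qed.

Lemma integral_addR U V : P.-integrable setT (EFin \o U) ->
  P.-integrable setT (EFin \o V) ->
  (\int[P]_w (U w + V w)%:E = \int[P]_w (U w)%:E + \int[P]_w (V w)%:E)%E.
Proof. by move=> iU iV; rewrite -(integralD_EFin measurableT iU iV). Qed.

Lemma integral_scaleR k U : P.-integrable setT (EFin \o U) ->
  (\int[P]_w (k * U w)%:E = k%:E * \int[P]_w (U w)%:E)%E.
Proof. by move=> iU; rewrite -(integralZl measurableT iU). Qed.

Lemma integral_cst_probability b : (\int[P]_w b%:E = b%:E)%E.
Proof.
have PT : P setT = 1%E by exact: probability_setT.
by rewrite integral_cst// [X in (_ * X)%E]PT mule1.
Qed.

Lemma mean_le_cst b : mean_le (fun=> b) b.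
Proof.
split; last by rewrite integral_cst_probability.
by apply: finite_measure_integrable_cst.
Qed.

Lemma mean_leW U b b' : b <= b' -> mean_le U b -> mean_le U b'.
Proof. by move=> bb [iU h]; split => //; apply: le_trans h _; rewrite lee_fin. Qed.

Lemma mean_leD U V a b : mean_le U a -> mean_le V b ->
  mean_le (fun w => U w + V w) (a + b).
Proof.
move=> [iU hU] [iV hV]; split; first exact: integrable_addR.
by rewrite integral_addR// EFinD leeD.
Qed.

Lemma mean_leZ k U b : 0 <= k -> mean_le U b -> mean_le (fun w => k * U w) (k * b).
Proof.
move=> k0 [iU hU]; split; first exact: integrable_scaleR.
by rewrite integral_scaleR// EFinM lee_wpmul2l.
Qed.

Lemma mean_le_sum (I : eqType) (r : seq I) (U : I -> Om -> R) (b : I -> R) :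
  (forall i, i \in r -> mean_le (U i) (b i)) ->
  mean_le (fun w => \sum_(i <- r) U i w) (\sum_(i <- r) b i).
Proof.
elim: r => [|i r IH] h.
  under eq_fun do rewrite big_nil.
  by rewrite big_nil; exact: mean_le_cst.
under eq_fun do rewrite big_cons.
rewrite big_cons; apply: mean_leD; first by apply: h; rewrite mem_head.
by apply: IH => k kr; apply: h; rewrite inE kr orbT.
Qed.

Lemma le_mean_le U V b : P.-integrable setT (EFin \o U) ->
  (forall w, U w <= V w) -> mean_le V b -> mean_le U b.
Proof.
move=> iU UV [iV hV]; split => //; apply: le_trans hV.
by apply: le_integral => // w _; rewrite lee_fin.
Qed.

Lemma same_mean_le U V b : same_mean U V -> mean_le V b -> mean_le U b.
Proof. by move=> [iU _ e] [_ h]; split => //; rewrite e. Qed.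

Lemma same_mean_cst b : same_mean (fun=> b) (fun=> b).
Proof. by have [i _] := mean_le_cst b. Qed.

Lemma same_meanD U V U' V' : same_mean U V -> same_mean U' V' ->
  same_mean (fun w => U w + U' w) (fun w => V w + V' w).
Proof.
move=> [i1 i2 e] [i1' i2' e']; split; try exact: integrable_addR.
by rewrite !integral_addR// e e'.
Qed.

Lemma same_meanZ k U V : same_mean U V ->
  same_mean (fun w => k * U w) (fun w => k * V w).
Proof.
move=> [i1 i2 e]; split; try exact: integrable_scaleR.
by rewrite !integral_scaleR// e.
Qed.

Lemma same_mean_sum (I : eqType) (r : seq I) (U V : I -> Om -> R) :
  (forall i, i \in r -> same_mean (U i) (V i)) ->
  same_mean (fun w => \sum_(i <- r) U i w) (fun w => \sum_(i <- r) V i w).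
Proof.
elim: r => [|i r IH] h.
  under [X in same_mean X _]eq_fun do rewrite big_nil.
  under [X in same_mean _ X]eq_fun do rewrite big_nil.
  exact: same_mean_cst.
under [X in same_mean X _]eq_fun do rewrite big_cons.
  under [X in same_mean _ X]eq_fun do rewrite big_cons.
apply: same_meanD; first by apply: h; rewrite mem_head.
by apply: IH => k kr; apply: h; rewrite inE kr orbT.
Qed.

(** Integrability is asked of the dominating [V] alone, which spares a measurability proof for the
    loss. *)
Lemma expectation_le U V b : (forall w, U w <= V w) -> mean_le V b ->
  ('E_P[U] <= b%:E)%E.
Proof.
move=> UV [_ h]; rewrite unlock; apply: le_trans h.
by apply: le_integral_nonmeasurable => w; rewrite lee_fin.
Qed.

Lemma expectation_abs_le U V V' b : (forall w, U w <= V w) -> mean_le V b ->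
  (forall w, - U w <= V' w) -> mean_le V' b -> (`|'E_P[U]| <= b%:E)%E.
Proof.
move=> UV hV UV' [iV' hV'].
have h1 := expectation_le UV hV.
have h2 : ((- b)%:E <= 'E_P[U])%E.
  rewrite unlock; apply: le_trans (_ : \int[P]_w (- 1 * V' w)%:E <= _)%E.
    by rewrite integral_scaleR// EFinN mulN1e leeN2.
  by apply: le_integral_nonmeasurable => w; rewrite lee_fin mulN1r lerNl.
by move: h1 h2; case: ('E_P[U])%E => [s| |]//=; rewrite !lee_fin ler_norml => -> ->.
Qed.

Lemma integrable_mul_bounded U B e : P.-integrable setT (EFin \o U) ->
  measurable_fun setT B -> (forall w, `|B w| <= e) ->
  P.-integrable setT (EFin \o (fun w => U w * B w)).
Proof.
move=> iU mB Be; have := integrableMl measurableT iU mB; apply.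
by exists e; split => [|x ex w _]; [exact: num_real|exact: le_trans (Be w) (ltW ex)].
Qed.

(** The sum counts the positive integers up to [x]: it is the integer part of [x]. *)
Lemma count_steps_le (x : R) n : 0 <= x <= n%:R ->
  x - 1 <= \sum_(0 <= k < n) (k.+1%:R <= x)%R%:R <= x.
Proof.
elim: n => [|n IH].
  by case/andP=> x0 x1; rewrite big_geq//; apply/andP; split; lra.
case/andP=> x0 xn; rewrite big_nat_recr//=; have [xn'|xn'] := leP x n%:R.
  have -> : (n.+1%:R <= x) = false by apply/lt_geF; rewrite -natr1 ltr_pwDr.
  by rewrite addr0; apply: IH; rewrite x0.
have -> : \sum_(0 <= k < n) (k.+1%:R <= x)%R%:R = n%:R :> R.
  rewrite -[in RHS](subn0 n) -sumr_const_nat; apply: eq_big_nat => k /andP[_ kn].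
  by rewrite (le_trans _ (ltW xn'))// ler_nat.
have : n.+1%:R = n%:R + 1 :> R by rewrite natr1.
by case: (leP n.+1%:R x) => h e; rewrite ?mulr0n ?mulr1n; apply/andP; split; lra.
Qed.

(* Layer-cake approximation: n B is within 1 of the number of k <= n such that
   B >= k / n. *)
Lemma mean_zero_mul_unit W B : P.-integrable setT (EFin \o W) ->
  measurable_fun setT B -> (forall w, 0 <= B w <= 1) ->
  (forall s : R, same_mean (fun w => W w * (s <= B w)%R%:R) (fun=> 0)) ->
  same_mean (fun w => W w * B w) (fun=> 0).
Proof.
move=> iW mB B01 layer.
have iWB : P.-integrable setT (EFin \o (fun w => W w * B w)).
  apply: (@integrable_mul_bounded _ _ 1) => // w; have /andP[h0 h1] := B01 w.
  by rewrite ger0_norm.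
have iaW := integrable_norm iW.
have i0 : P.-integrable setT (EFin \o (fun=> 0 : R)) by have [] := same_mean_cst 0.
split => //; rewrite [RHS]integral0.
pose m := fine (\int[P]_w (`|W w|)%:E)%E.
have hm : mean_le (fun w => `|W w|) m.
  split => //; rewrite /m fineK//.
  exact: (integrable_fin_num measurableT iaW).
have m0 : 0 <= m by rewrite fine_ge0// integral_ge0// => w _; rewrite lee_fin.
(* [sg] stands for 1 or -1, so that one estimate bounds the mean from both sides. *)
have bound n (sg : R) : (0 < n)%N -> sg ^+ 2 = 1 ->
    mean_le (fun w => sg * (W w * B w)) (n%:R^-1 * m).
  move=> n0 sg1; have n1 : 0 < n%:R :> R by rewrite ltr0n.
  have approx : same_mean (fun w => sg * \sum_(0 <= k < n) n%:R^-1 *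
      (W w * (k.+1%:R / n%:R <= B w)%R%:R)) (fun w => sg * \sum_(0 <= k < n) n%:R^-1 * 0).
    by apply: same_meanZ; apply: same_mean_sum => k _; exact/same_meanZ/layer.
  have approx0 : mean_le (fun w => sg * \sum_(0 <= k < n) n%:R^-1 *
      (W w * (k.+1%:R / n%:R <= B w)%R%:R)) 0.
    apply: same_mean_le approx _.
    rewrite (_ : sg * _ = 0); first exact: mean_le_cst.
    by rewrite big1 ?mulr0// => k _; rewrite mulr0.
  rewrite -[n%:R^-1 * m]add0r.
  apply: le_mean_le (mean_leD approx0 (mean_leZ _ hm)).
  - exact: integrable_scaleR.
  - move=> w; have /andP[b0 b1] := B01 w.
    have := @count_steps_le (n%:R * B w) n.
    rewrite mulr_ge0//= ler_piMr// => /(_ isT).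
    have -> : \sum_(0 <= k < n) n%:R^-1 * (W w * (k.+1%:R / n%:R <= B w)%R%:R) =
        n%:R^-1 * W w * \sum_(0 <= k < n) (k.+1%:R <= n%:R * B w)%R%:R.
      rewrite mulr_sumr; apply: eq_bigr => k _.
      by rewrite ler_pdivrMr// [B w * _]mulrC mulrA.
    set c := \sum_(_ <= _ < _) _ => /andP[c1 c2].
    rewrite -subr_ge0.
    have -> : sg * (n%:R^-1 * W w * c) + n%:R^-1 * `|W w| - sg * (W w * B w) =
        n%:R^-1 * (`|W w| - sg * W w * (n%:R * B w - c)).
      by field; rewrite lt0r_neq0.
    rewrite mulr_ge0 ?invr_ge0 ?(ltW n1)// subr_ge0.
    have sgN : `|sg| = 1.
      by apply/eqP; rewrite -(@eqrXn2 _ 2)// expr1n -normrX sg1 normr1.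
    apply: le_trans (ler_norm _) _; rewrite !normrM sgN mul1r ler_piMr//.
    by rewrite ler_norml; apply/andP; split; lra.
  - by rewrite invr_ge0.
have fWB := integrable_fin_num measurableT iWB.
rewrite -(fineK fWB); congr EFin; apply/eqP; rewrite -normr_le0.
set v := fine _.
have vn n : (0 < n)%N -> `|v| <= n%:R^-1 * m.
  move=> n0; rewrite ler_norml; apply/andP; split.
    have [_] := bound n (- 1) n0 ltac:(by rewrite sqrrN expr1n).
    by rewrite integral_scaleR// -(fineK fWB) -/v -EFinM lee_fin mulN1r lerNl.
  have [_] := bound n 1 n0 ltac:(by rewrite expr1n).
  by rewrite integral_scaleR// -(fineK fWB) -/v -EFinM lee_fin mul1r.
(* A nonzero mean [v] would contradict [|v| <= m / n] for [n] beyond [m / |v|]. *)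
rewrite leNgt; apply/negP => v0.
have := archi_boundP (divr_ge0 m0 (ltW v0)).
set n := Num.bound _ => hn.
have n0 : (0 < n)%N.
  by rewrite -(ltr0n R) (le_lt_trans _ hn)// divr_ge0// ltW.
have := vn n n0; rewrite leNgt mulrC ltr_pdivrMr ?ltr0n// mulrC.
by rewrite ltr_pdivrMr// in hn; rewrite hn.
Qed.

Section ConditionalExpectation.
Variable G : set (set Om).
Hypothesis G_setT : G setT.

Lemma cond_exp_same_mean U V : is_cond_exp P G U V -> same_mean U V.
Proof. by move=> [iU iV _ h]; split => //; exact: (h setT G_setT). Qed.

Lemma cond_exp_indic U V (A : set Om) : is_cond_exp P G U V -> G A -> measurable A ->
  same_mean (fun w => U w * \1_A w) (fun w => V w * \1_A w).
Proof.
move=> [iU iV _ h] GA mA.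
have bd w : `|\1_A w| <= 1 :> R.
  by rewrite indicE; case: (_ \in _); rewrite ?normr1 ?normr0.
split; try by apply: (@integrable_mul_bounded _ _ 1) => //; exact: measurable_indic.
have e Z : (\int[P]_w (Z w * \1_A w)%:E = \int[P]_(w in A) (Z w)%:E)%E.
  rewrite [RHS]integral_mkcond; apply: eq_integral => w _.
  by rewrite patchE indicE; case: (_ \in _); rewrite ?mulr1 ?mulr0.
by rewrite !e; exact: h.
Qed.

(** A bounded factor measurable for [G] can be pulled out. [W = U - V] has mean 0 on the superlevel
    sets of [B]; an affine map brings [B] into the unit interval, where the layer argument
    applies. *)
Lemma cond_exp_mul U V B e : is_cond_exp P G U V -> measurable_fun setT B ->
  (forall w, `|B w| <= e) -> (forall s : R, G [set w | s <= B w]) ->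
  same_mean (fun w => U w * B w) (fun w => V w * B w).
Proof.
move=> ce mB Be GB; have [iU iV _ _] := ce.
have iUB := integrable_mul_bounded iU mB Be.
have iVB := integrable_mul_bounded iV mB Be.
pose c := `|e| + 1; have c0 : 0 < c by rewrite ltr_wpDl.
have Bc w : `|B w| <= c.
  by apply: le_trans (Be w) _; apply: le_trans (ler_norm _) _; rewrite lerDl.
pose W w := U w + - 1 * V w.
pose B' w := (2 * c)^-1 * (B w + c).
have iW : P.-integrable setT (EFin \o W) by apply: integrable_addR => //; exact: integrable_scaleR.
have W0 : same_mean W (fun=> 0).
  have [_ _ eUV] := cond_exp_same_mean ce.
  split => //; first by have [] := same_mean_cst 0.
  rewrite /W integral_addR//; last exact: integrable_scaleR.
  rewrite integral_scaleR// eUV integral0 EFinN mulN1e subee//.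
  exact: (integrable_fin_num measurableT iV).
have mB' : measurable_fun setT B'.
  by apply: measurable_funM => //; apply: measurable_funD.
have layer (s : R) : same_mean (fun w => W w * (s <= B' w)%R%:R) (fun=> 0).
  pose A := [set w | 2 * c * s - c <= B w].
  have mA : measurable A.
    have -> : A = setT `&` B @^-1` `[2 * c * s - c, +oo[%classic.
      by apply/seteqP; split => w; rewrite /A /= in_itv/= andbT// => -[].
    exact: mB.
  have [i1 i2 e12] := cond_exp_indic ce (GB (2 * c * s - c)) mA.
  have WA : (fun w => W w * (s <= B' w)%R%:R) =
      (fun w => U w * \1_A w + - 1 * (V w * \1_A w)).
    apply/funext => w; rewrite indicE.
    have -> : (w \in A) = (s <= B' w).
      rewrite /B' ler_pdivlMl ?mulr_gt0// -lerBlDr.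
      by apply/idP/idP; rewrite inE.
    by rewrite /W; ring.
  rewrite WA; split; first by apply: integrable_addR => //; exact: integrable_scaleR.
    by have [] := same_mean_cst 0.
  rewrite integral_addR//; last exact: integrable_scaleR.
  rewrite integral_scaleR// e12 integral0 EFinN mulN1e subee//.
  exact: (integrable_fin_num measurableT i2).
have B'01 w : 0 <= B' w <= 1.
  have := Bc w; rewrite ler_norml => /andP[h1 h2].
  rewrite /B' ler_pdivrMl ?mulr_gt0// mulr_ge0 ?invr_ge0 ?mulr_ge0 ?(ltW c0)//=; lra.
have WB' := mean_zero_mul_unit iW mB' B'01 layer.
(* [U B = 2 c W B' - c W + V B]; the first two terms have mean 0. *)
have := same_meanD (same_meanD (same_meanZ (2 * c) WB') (same_meanZ (- c) W0))
  (And3 iVB iVB erefl : same_mean (fun w => V w * B w) (fun w => V w * B w)).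
congr same_mean; apply/funext => w; last by rewrite !mulr0 !add0r.
by rewrite /W /B'; field; rewrite lt0r_neq0.
Qed.

End ConditionalExpectation.
End Mean.

(** * One block of the algorithm *)

(** Summation by parts: each increase of [a] is paid by [S <= D]. The induction keeps the last term
    [- a m.+1 * S m.+2], which the next round consumes. *)
Lemma abel_telescope_le (R : realType) (a S : nat -> R) (D : R) (T : nat) :
  (0 < T)%N -> (forall t, (1 <= t < T)%N -> a t <= a t.+1) ->
  (forall t, (1 <= t <= T)%N -> 0 <= a t) ->
  (forall t, (1 <= t <= T.+1)%N -> 0 <= S t <= D) ->
  \sum_(1 <= t < T.+1) a t * (S t - S t.+1) <= a T * D.
Proof.
case: T => // T _ amono a0 SD.
suff H m : (m <= T)%N ->
    \sum_(1 <= t < m.+2) a t * (S t - S t.+1) <= a m.+1 * D - a m.+1 * S m.+2.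
  apply: le_trans (H T (leqnn _)) _; rewrite gerBl mulr_ge0 ?a0 ?leqnn//.
  by have /andP[] := SD T.+2 (leqnn _).
elim: m => [|m IH] mT.
  rewrite big_nat1; have /andP[_] := SD 1%N isT; have := a0 1%N isT; nra.
rewrite big_nat_recr//=.
have := IH (ltnW mT); have /andP[_] := SD m.+2 (ltnW mT : (0 < m.+2 <= T.+2)%N).
have := amono m.+1 (mT : (0 < m.+1 < T.+1)%N); nra.
Qed.

Lemma shifted_geometric_sum_le (R : realType) (r : R) (a m : nat) : 0 <= r < 1 ->
  \sum_(0 <= t < m) (if (a < t)%N then r ^+ (t - a) else 0) <= r / (1 - r).
Proof.
move=> r01; suff -> : \sum_(0 <= t < m) (if (a < t)%N then r ^+ (t - a) else 0) =
    \sum_(0 <= k < m - a.+1) r ^+ k.+1 by exact: geometric_sum_le.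
elim: m => [|m IH]; first by rewrite sub0n !big_geq.
rewrite big_nat_recr//= IH; case: ltnP => am; last first.
  by rewrite addr0 !big_geq// ?subSS leqn0 subn_eq0// leqW.
by rewrite subSS -(subnSK am) big_nat_recr.
Qed.

Lemma spread_le (R : realType) (n d : nat) (N : 'cV[R]_d -> R) (sigma : R) q c c' Z :
  c <= c' -> @spread R n sigma d N q c Z -> spread sigma N q c' Z.
Proof.
by move=> cc [Phi [v [h1 h2 h3]]]; exists Phi, v; split => //; exact: le_trans cc.
Qed.

Section Block.
Context (R : realType) (dd : measure_display) (Om : measurableType dd).
Context (n d T : nat) (N : 'cV[R]_d -> R) (phi : 'cV[R]_d -> R) (X : set 'cV[R]_d).
Context (rho zeta KX MX : R) (E : nat -> rel 'I_n) (A : nat -> 'M[R]_n).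
Context (alpha : nat -> R) (K : nat -> nat) (B : nat -> 'M[R]_d).
Context (u1 : 'I_n -> 'cV[R]_d) (us : nat -> 'cV[R]_d).
Context (g : 'I_n -> nat -> Om -> 'cV[R]_d) (r : block_run Om R n d).
Hypothesis hN : is_norm N.
Hypothesis n_gt0 : (0 < n)%N.
Hypothesis T_gt0 : (0 < T)%N.
Hypothesis cX : convex_set X.
Hypothesis X_diam : forall x x', X x -> X x' -> N (x - x') <= MX.
Hypothesis zeta01 : 0 < zeta < 1.
Hypothesis A_stoch : forall t, (1 <= t <= T)%N -> doubly_stochastic (A t).
Hypothesis A_weight : forall t i j, (1 <= t <= T)%N ->
  (j \in in_nbhd (E t) i -> zeta < A t i j) /\
  (j \notin in_nbhd (E t) i -> A t i j = 0).
Hypothesis E_conn : forall t, (1 <= t <= T)%N -> strongly_connected (E t).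
Hypothesis phi_diff : forall x, differentiable (phi : 'cV[R]_d -> R^o) x.
Hypothesis rho0 : 0 < rho.
Hypothesis phi_conv : strongly_convex_on N rho X phi.
Hypothesis u1X : forall i, X (u1 i).
Hypothesis alpha0 : forall t, (1 <= t <= T)%N -> 0 < alpha t.
Hypothesis alpha_noninc : forall t, (1 <= t < T)%N -> alpha t.+1 <= alpha t.
Hypothesis K0 : forall t, (1 <= t <= T)%N -> (0 < K t)%N.
Hypothesis alg : block_algorithm T phi X alpha K E A B u1 g r.
Hypothesis phi_lip : forall a b c, X a -> X b -> X c ->
  `|bregman phi a c - bregman phi b c| <= KX * N (a - b).
Hypothesis phi_jensen : forall (s : 'I_n -> R) x (z : 'I_n -> 'cV[R]_d), simplex s ->
  bregman phi x (\sum_i s i *: z i) <= \sum_i s i * bregman phi x (z i).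
Hypothesis B_nonexp : forall t a b, (1 <= t <= T)%N -> X a -> X b ->
  bregman phi (B t *m a) (B t *m b) <= bregman phi a b.
Hypothesis B_norm : forall t, (1 <= t <= T)%N -> op_norm N (B t) <= 1.
Hypothesis B_X : forall t x, (1 <= t <= T)%N -> X x -> X (B t *m x).
Hypothesis us_X : forall t, (1 <= t)%N -> X (us t).

Let sigma : R := 1 - zeta / (4 * n%:R ^+ 2).
(** The default [K 1] does not alter the minimum, since round 1 is in the range. *)
Let Kmin := \big[minn/K 1%N]_(1 <= t < T.+1) K t.
Let c := sigma^-1 * sigma ^+ (Kmin - 1)%N / (1 - sigma ^+ Kmin).

Lemma sigma_lt1 : 0 < sigma < 1.
Proof.
have n1 : 1 <= n%:R :> R by rewrite ler1n.
case/andP: zeta01 => z0 z1.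
have D0 : 1 <= n%:R ^+ 2 :> R by rewrite exprn_ege1.
apply/andP; split; last by rewrite ltrBlDr ltrDl divr_gt0// mulr_gt0// (lt_le_trans ltr01).
rewrite subr_gt0 ltr_pdivrMr ?mul1r; last by rewrite mulr_gt0// (lt_le_trans ltr01).
lra.
Qed.

Let sigma01 : 0 <= sigma <= 1.
Proof. by case/andP: sigma_lt1 => s0 s1; rewrite !ltW. Qed.

Lemma Kmin_le t : (1 <= t <= T)%N -> (Kmin <= K t)%N.
Proof.
rewrite -[(t <= T)%N]ltnS -mem_index_iota /Kmin; elim: (index_iota _ _) => //= s l IH.
rewrite inE big_cons geq_min => /predU1P[->|/IH ->]; first by rewrite leqnn.
by rewrite orbT.
Qed.

Lemma Kmin_gt0 : (0 < Kmin)%N.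
Proof.
rewrite /Kmin big_nat_cond; elim/big_ind: _ => [|p q p0 q0|t].
- by apply: K0; rewrite T_gt0.
- by rewrite leq_min p0.
- by rewrite andbT => /K0.
Qed.

Lemma consensus_sum i t k w : (1 <= t <= T)%N -> (1 <= k <= K t)%N ->
  consensus r i t k.+1 w = \sum_j A t i j *: consensus r j t k w.
Proof.
move=> tT kK; rewrite (block_consensus alg)// big_mkcond/=.
apply: eq_bigr => j _; case: ifPn => // /(A_weight i j tT).2 ->.
by rewrite scale0r.
Qed.

Lemma consensus_in i t k w : (1 <= t <= T)%N -> (k <= K t)%N ->
  X (consensus r i t k.+1 w).
Proof.
move=> tT; elim: k i => [|k IH] i kK.
  by rewrite (block_predict alg)//; apply: B_X => //; case: (block_proj alg i w tT).
have [A0 A1 _] := A_stoch tT.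
rewrite consensus_sum//; apply: convex_set_sum => // j; exact/IH/ltnW.
Qed.

Lemma decision_in i t w : (1 <= t <= T.+1)%N -> X (decision r i t w).
Proof.
case: t => // -[_|t tT]; first by rewrite (block_init alg).
by rewrite (block_next alg)//; apply: consensus_in.
Qed.

Lemma projected_in i t w : (1 <= t <= T)%N -> X (projected r i t w).
Proof. by move=> tT; case: (block_proj alg i w tT). Qed.

(** All agents apply the same [B t] before averaging, so a whole round is one mixing matrix acting
    on the predicted points. *)
Lemma decision_mixing t w : (1 <= t <= T)%N -> exists2 M, mixing sigma (K t) M &
  forall i, decision r i t.+1 w = \sum_j M i j *: (B t *m projected r j t w).
Proof.
move=> tT.
suff [M hM cM] : exists2 M, mixing sigma (K t) M & forall i,
    consensus r i t (K t).+1 w = \sum_j M i j *: consensus r j t 1 w.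
  exists M => // i; rewrite (block_next alg)// cM.
  by apply: eq_bigr => j _; rewrite (block_predict alg).
elim: {-2}(K t) (leqnn (K t)) => [|k IH] kK.
  exists 1%:M; first exact: mixing1.
  move=> i; rewrite (bigD1 i)//= mxE eqxx scale1r big1 ?addr0// => j ji.
  by rewrite mxE eq_sym (negbTE ji) scale0r.
have [M hM cM] := IH (ltnW kK).
exists (A t *m M).
  rewrite -add1n; apply: mixing_mulmx hM.
  by apply: mixing_weight_matrix (E_conn tT) => //; [exact: A_stoch|move=> i j; exact: A_weight].
move=> i; rewrite consensus_sum//; under eq_bigr do rewrite cM scaler_sumr.
rewrite exchange_big/=; apply: eq_bigr => j _; rewrite mxE scaler_suml.
by apply: eq_bigr => l _; rewrite scalerA.
Qed.

Lemma projected_step i t w : (1 <= t <= T)%N ->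
  N (projected r i t w - decision r i t w) <= alpha t / rho * dual_norm N (g i t w).
Proof.
move=> tT; have [pX pmin] := block_proj alg i w tT.
have dX : X (decision r i t w).
  by apply: decision_in; case/andP: tT => -> /leqW.
exact: (mirror_step_length hN phi_diff cX phi_conv rho0 (alpha0 tT) dX pX
  (block_step alg i w tT) pmin).
Qed.

Let step_bound s w := \sum_i alpha s / rho * dual_norm N (g i s w).
Let source_bound s w := if s is 0%N then \sum_i N (u1 i) else step_bound s w.

(* x_{i,t} is a sum of the contributions of the initial points (s = 0) and of
   the mirror steps of the rounds s < t, each averaged in all later rounds. *)
Lemma decision_decomposition t w : (t <= T)%N -> exists Y : nat -> 'I_n -> 'cV[R]_d,
  (forall i, decision r i t.+1 w = \sum_(0 <= s < t.+1) Y s i) /\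
  (forall s, (s <= t)%N ->
     spread sigma N (Kmin * (t.+1 - maxn s 1)) (source_bound s w) (Y s)).
Proof.
elim: t => [_|t IH tT].
  exists (fun=> u1); split => [i|s]; first by rewrite big_nat1 (block_init alg).
  by rewrite leqn0 => /eqP ->; rewrite subnn muln0; exact: spread0.
have [Y [Ysum Yspread]] := IH (ltnW tT).
have tT' : (1 <= t.+1 <= T)%N by [].
have [M hM dM] := decision_mixing w tT'.
pose e j := projected r j t.+1 w - decision r j t.+1 w.
(* Old contributions go through the new round, and so does the new mirror step [e]. A step of round
   [s] is averaged in its own round already, and the initial points enter at time 1: hence
   [t.+1 - maxn s 1] rounds. *)
exists (fun s i => \sum_j M i j *: (B t.+1 *m (if (s <= t)%N then Y s j else e j))).
have hB := op_norm_le1 hN (B_norm tT').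
split => [i|s st].
  rewrite big_nat_recr//= ltnn dM -[RHS]addr0 -[X in _ = X + 0]addrC addr0.
  rewrite [X in _ + X](eq_big_nat _ _ (F2 := fun s => \sum_j M i j *: (B t.+1 *m Y s j))).
    rewrite exchange_big/= -big_split/=; apply: eq_bigr => j _.
    rewrite -scaler_sumr -mulmx_sumr -Ysum -scalerDr -mulmxDr.
    by rewrite /e subrK.
  by move=> s /andP[_]; rewrite ltnS => ->.
have KK := Kmin_le tT'.
have [{}st|ts] := leqP s t.
  apply: (@spreadW _ _ _ sigma01 _ _ _ (K t.+1 + Kmin * (t.+1 - maxn s 1))).
    have m1 : (maxn s 1 <= t.+1)%N by rewrite geq_max leqW.
    by rewrite subSn// mulnS leq_add2r.
  by apply: spread_mix hM _; apply: spread_linear => //; exact: Yspread.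
have -> : s = t.+1 by apply/eqP; rewrite eqn_leq st.
apply: (@spreadW _ _ _ sigma01 _ _ _ (K t.+1 + 0)).
  by rewrite (maxn_idPl _)// subSnn muln1 addn0.
apply: spread_mix hM _; apply: spread_linear => //.
apply: spread_le (spread0 sigma N e).
by apply: ler_sum => j _; exact: projected_step.
Qed.

Let rate := sigma ^+ Kmin.

Let rate01 : 0 <= rate < 1.
Proof.
case/andP: sigma_lt1 => s0 s1; rewrite exprn_ge0 ?(ltW s0)//=.
by rewrite exprn_ilt1 ?(ltW s0)// -lt0n Kmin_gt0.
Qed.

Lemma source_bound_ge0 s w : (s <= T)%N -> 0 <= source_bound s w.
Proof.
case: s => [_|s sT]; first by apply: sumr_ge0 => i _; exact: is_norm_ge0.
apply: sumr_ge0 => i _; rewrite mulr_ge0 ?dual_norm_ge0// divr_ge0 ?(ltW rho0)//.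
exact/ltW/alpha0.
Qed.

Lemma deviation_le t w : (1 <= t <= T)%N ->
  \sum_i N (decision r i t w - average (fun j => decision r j t w)) <=
  n%:R * \sum_(0 <= s < t) rate ^+ (t - maxn s 1) * source_bound s w.
Proof.
case: t => // t /ltnW tT; have [Y [Ysum Yspread]] := decision_decomposition w tT.
have -> : average (fun j => decision r j t.+1 w) = \sum_(0 <= s < t.+1) average (Y s).
  by rewrite -average_sum; congr average; apply/funext => i; exact: Ysum.
apply: le_trans (_ : \sum_(i < n) \sum_(0 <= s < t.+1)
    rate ^+ (t.+1 - maxn s 1) * source_bound s w <= _); last first.
  by rewrite sumr_const card_ord mulr_natl.
apply: ler_sum => i _; rewrite Ysum -sumrB; apply: le_trans (is_norm_sum hN _ _ _) _.
rewrite big_nat_cond [leRHS]big_nat_cond; apply: ler_sum => s.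
rewrite andbT ltnS => /andP[_ st]; rewrite -exprM.
exact: (spread_deviation sigma01 hN i (Yspread s st)).
Qed.

Lemma sum_deviation_le w :
  \sum_(1 <= t < T.+1)
    \sum_i N (decision r i t w - average (fun j => decision r j t w)) <=
  \sum_i N (u1 i - average u1) +
  n%:R * c * (\sum_i N (u1 i) + \sum_(1 <= s < T.+1) step_bound s w).
Proof.
have [r0 r1] := andP rate01; have [s0 s1] := andP sigma_lt1.
(* Round 1 precedes all averaging and contributes the deviation of the initial points as it is; the
   decay starts at round 2. *)
rewrite big_ltn//; apply: lerD.
  rewrite (_ : (fun j => decision r j 1 w) = u1); last first.
    by apply/funext => i; rewrite (block_init alg).
  by apply: ler_sum => i _; rewrite (block_init alg).
have -> : \sum_i N (u1 i) + \sum_(1 <= s < T.+1) step_bound s w =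
    \sum_(0 <= s < T.+1) source_bound s w.
  rewrite [RHS]big_ltn//; congr (_ + _).
  by apply: eq_big_nat => -[].
(* The condition on [s] and [t] moves into the summand, so that the two sums can be exchanged and
   each source yields a geometric series. *)
apply: le_trans (_ : \sum_(2 <= t < T.+1) n%:R * \sum_(0 <= s < T.+1)
    (if (maxn s 1 < t)%N then rate ^+ (t - maxn s 1) else 0) * source_bound s w <= _).
  rewrite big_nat_cond [leRHS]big_nat_cond; apply: ler_sum => t.
  rewrite andbT => /andP[t2 tT].
  apply: le_trans (deviation_le w _) _; first by rewrite (ltnW t2).
  rewrite ler_wpM2l// [leRHS](big_cat_nat (n := t))//= ?(ltnW tT)//.
  rewrite -[leLHS]addr0; apply: lerD.
    rewrite big_nat_cond [leRHS]big_nat_cond; apply: ler_sum => s.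
    by rewrite andbT => /andP[_ st]; rewrite gtn_max st t2.
  rewrite big_nat_cond; apply: sumr_ge0 => s; rewrite andbT ltnS => /andP[_ sT].
  by rewrite mulr_ge0 ?source_bound_ge0//; case: ifP => // _; exact: exprn_ge0.
rewrite -mulr_sumr -mulrA ler_wpM2l// exchange_big/= mulr_sumr.
rewrite big_nat_cond [leRHS]big_nat_cond; apply: ler_sum => s.
rewrite andbT ltnS => /andP[_ sT]; rewrite -mulr_suml.
apply: ler_wpM2r; first exact: source_bound_ge0.
apply: le_trans (_ : rate / (1 - rate) <= _).
  apply: le_trans (shifted_geometric_sum_le (maxn s 1) T.+1 rate01).
  rewrite [leRHS](big_cat_nat (n := 2))//=.
  by rewrite lerDr sumr_ge0// => t _; case: ifP => // _; exact: exprn_ge0.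
(* There is room here: [sigma ^+ Kmin <= sigma^-1 * sigma ^+ (Kmin - 1)] because [sigma <= 1]. *)
rewrite /c -/rate ler_wpM2r ?invr_ge0 ?subr_ge0 ?(ltW r1)//.
rewrite ler_pdivlMl// /rate -{1}(prednK Kmin_gt0) exprS subn1 mulrA.
by rewrite ler_piMl ?exprn_ge0 ?(ltW s0)// mulr_ile1// ltW.
Qed.

Lemma bregman_consensus_le u t w : (1 <= t <= T)%N ->
  \sum_i bregman phi u (decision r i t.+1 w) <=
  \sum_i bregman phi u (B t *m projected r i t w).
Proof.
move=> tT; have [A0 A1 A2] := A_stoch tT.
under eq_bigr do rewrite (block_next alg)//.
under [leRHS]eq_bigr do rewrite -(block_predict alg)//.
elim: {-2}(K t) (leqnn (K t)) => [|k IH] // kK.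
apply: le_trans (IH (ltnW kK)).
apply: le_trans (_ : \sum_i \sum_j A t i j * bregman phi u (consensus r j t k.+1 w) <= _).
  by apply: ler_sum => i _; rewrite consensus_sum//; apply: phi_jensen.
rewrite exchange_big/=; apply: ler_sum => j _.
by rewrite -mulr_suml A2 mul1r.
Qed.

Lemma bregman_diameter_ge a b : X a -> X b -> bregman phi a b <= bregman_diameter phi X.
Proof.
move=> Xa Xb; apply: ub_le_sup; last by exists (a, b).
(* The sign of [KX] is not given, hence the absolute value. *)
exists (`|KX| * MX) => _ [[p q] [/= Xp Xq] <-].
have := phi_lip Xp Xq Xq; rewrite bregman_refl subr0 => h.
apply: le_trans (ler_norm _) _; apply: le_trans h _.
apply: le_trans (_ : `|KX| * N (p - q) <= _).
  by rewrite ler_wpM2r ?is_norm_ge0// ler_norm.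
by rewrite ler_wpM2l// X_diam.
Qed.

Lemma bregman_ge0 a b : X a -> X b -> 0 <= bregman phi a b.
Proof.
move=> Xa Xb; apply: le_trans (bregman_ge phi_diff phi_conv Xa Xb).
by rewrite mulr_ge0 ?sqr_ge0// divr_ge0// ltW.
Qed.

Lemma sum_linearized_regret_le w :
  \sum_(1 <= t < T.+1) \sum_i dotv (g i t w) (decision r i t w - us t) <=
  n%:R * bregman_diameter phi X / alpha T +
  n%:R * KX * (\sum_(1 <= t < T.+1) (alpha t)^-1 * N (us t.+1 - B t *m us t)) +
  \sum_(1 <= t < T.+1) alpha t / (2 * rho) * \sum_i dual_norm N (g i t w) ^+ 2.
Proof.
pose S t := \sum_i bregman phi (us t) (decision r i t w).
have SD t : (1 <= t <= T.+1)%N -> 0 <= S t <= n%:R * bregman_diameter phi X.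
  move=> tT; have usX : X (us t) by apply: us_X; case/andP: tT.
  rewrite sumr_ge0/= => [|i _]; last by apply: bregman_ge0 => //; exact: decision_in.
  rewrite mulr_natl -[n in leRHS]card_ord -sumr_const; apply: ler_sum => i _.
  by apply: bregman_diameter_ge => //; exact: decision_in.
have round t : (1 <= t <= T)%N ->
    \sum_i dotv (g i t w) (decision r i t w - us t) <=
    (alpha t)^-1 * (S t - S t.+1) +
    n%:R * KX * ((alpha t)^-1 * N (us t.+1 - B t *m us t)) +
    alpha t / (2 * rho) * \sum_i dual_norm N (g i t w) ^+ 2.
  move=> tT; have [t1 tT'] := andP tT.
  have dX i : X (decision r i t w) by apply: decision_in; rewrite t1 leqW.
  (* The comparator moves from [us t] to [us t.+1] through [B t *m us t]: the prediction does not
     increase the divergence, and the remaining drift is paid by the Lipschitz bound. *)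
  have SS : S t.+1 <= \sum_i bregman phi (us t) (projected r i t w) +
      n%:R * KX * N (us t.+1 - B t *m us t).
    apply: le_trans (bregman_consensus_le _ _ tT) _.
    have -> : n%:R * KX * N (us t.+1 - B t *m us t) =
        \sum_(i < n) KX * N (us t.+1 - B t *m us t).
      by rewrite sumr_const card_ord -mulrA mulr_natl.
    rewrite -big_split/=; apply: ler_sum => i _.
    apply: le_trans (lerD (B_nonexp tT (us_X t1) (projected_in i w tT)) (lexx _)).
    rewrite -lerBlDl; apply: le_trans (ler_norm _) _.
    by apply: phi_lip; [exact: us_X|apply: B_X => //; exact: us_X|
      apply: B_X => //; exact: projected_in].
  have ai : 0 <= (alpha t)^-1 by rewrite invr_ge0 ltW// alpha0.
  apply: le_trans (_ : \sum_i ((alpha t)^-1 * (bregman phi (us t) (decision r i t w)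
     - bregman phi (us t) (projected r i t w)) +
     alpha t / (2 * rho) * dual_norm N (g i t w) ^+ 2) <= _).
    apply: ler_sum => i _; have [pX pmin] := block_proj alg i w tT.
    exact: (mirror_step_regret hN phi_diff cX phi_conv rho0 (alpha0 tT) (dX i) pX
      (block_step alg i w tT) pmin (us_X t1)).
  rewrite big_split/= -!mulr_sumr lerD2r sumrB.
  have := ler_wpM2l ai SS; rewrite -/(S t); lra.
apply: le_trans (_ : \sum_(1 <= t < T.+1) ((alpha t)^-1 * (S t - S t.+1) +
    n%:R * KX * ((alpha t)^-1 * N (us t.+1 - B t *m us t)) +
    alpha t / (2 * rho) * \sum_i dual_norm N (g i t w) ^+ 2) <= _).
  rewrite big_nat_cond [leRHS]big_nat_cond; apply: ler_sum => t.
  by rewrite andbT ltnS => /round.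
rewrite !big_split/= -mulr_sumr !lerD2r mulrC.
apply: abel_telescope_le => // t tT.
  have [t1 t2] := andP tT.
  by rewrite lef_pV2 ?posrE ?alpha_noninc ?alpha0// ?t1 ?(ltnW t2).
by rewrite invr_ge0 ltW// alpha0.
Qed.

(** * Expected consensus error and expected linearised regret of one block *)

Section Means.
Context (P : probability Om R) (L : R) (D : 'I_n -> nat -> Om -> 'cV[R]_d).
Hypothesis L0 : 0 <= L.
Hypothesis g_sqr : forall i t, (1 <= t <= T)%N ->
  mean_le P (fun w => dual_norm N (g i t w) ^+ 2) (L ^+ 2).
Hypothesis g_unbiased : forall i t, (1 <= t <= T)%N ->
  same_mean P (fun w => dotv (D i t w) (decision r i t w - us t))
              (fun w => dotv (g i t w) (decision r i t w - us t)).

(** The error is dominated by an affine function [V] of the squared dual norms, whose integrability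
    is known; [(L - |g|)^2 >= 0] trades the first moment for the second. *)
Lemma network_error_mean : exists2 V : Om -> R,
  (forall w, L * (\sum_(1 <= t < T.+1)
     \sum_i N (decision r i t w - average (fun j => decision r j t w))) <= V w) &
  mean_le P V (L * (\sum_i N (u1 i - average u1)) + n%:R * c *
    (L * (\sum_i N (u1 i)) + n%:R * L ^+ 2 / rho * \sum_(1 <= t < T.+1) alpha t)).
Proof.
have [s0 s1] := andP sigma_lt1; have [r0 r1] := andP rate01.
have c0 : 0 <= n%:R * c.
  rewrite /c mulr_ge0// mulr_ge0 ?invr_ge0 ?subr_ge0 ?(ltW r1)//.
  by rewrite mulr_ge0 ?invr_ge0 ?exprn_ge0// ltW.
exists (fun w => L * (\sum_i N (u1 i - average u1)) + n%:R * c *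
    (L * (\sum_i N (u1 i)) + \sum_(1 <= t < T.+1) alpha t / rho *
      \sum_i 2^-1 * (dual_norm N (g i t w) ^+ 2 + L ^+ 2))).
  move=> w; apply: le_trans (ler_wpM2l L0 (sum_deviation_le w)) _.
  rewrite mulrDr lerD2l mulrCA ler_wpM2l// mulrDr lerD2l mulr_sumr.
  rewrite big_nat_cond [leRHS]big_nat_cond; apply: ler_sum => t.
  rewrite andbT ltnS => tT; rewrite /step_bound -mulr_sumr mulrCA.
  rewrite ler_wpM2l ?divr_ge0 ?(ltW rho0) ?(ltW (alpha0 tT))// mulr_sumr.
  apply: ler_sum => i _; have := sqr_ge0 (L - dual_norm N (g i t w)); lra.
apply: mean_leD (mean_le_cst _ _) _; apply: mean_leZ => //.
apply: mean_leD (mean_le_cst _ _) _.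
rewrite mulr_sumr; apply: mean_le_sum => t; rewrite mem_index_iota ltnS => tT.
have -> : n%:R * L ^+ 2 / rho * alpha t =
    alpha t / rho * \sum_(i < n) 2^-1 * (L ^+ 2 + L ^+ 2).
  by rewrite sumr_const card_ord -mulr_natl; field; rewrite lt0r_neq0.
apply: mean_leZ; first by rewrite divr_ge0 ?(ltW rho0) ?(ltW (alpha0 tT)).
apply: mean_le_sum => i _; apply: mean_leZ; first by rewrite invr_ge0.
by apply: mean_leD (mean_le_cst _ _); exact: g_sqr.
Qed.

Lemma linearized_regret_mean :
  mean_le P (fun w => \sum_(1 <= t < T.+1) \sum_i dotv (D i t w) (decision r i t w - us t))
    (n%:R * bregman_diameter phi X / alpha T +
     n%:R * KX * (\sum_(1 <= t < T.+1) (alpha t)^-1 * N (us t.+1 - B t *m us t)) +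
     n%:R * L ^+ 2 / rho * \sum_(1 <= t < T.+1) alpha t).
Proof.
have same : same_mean P
    (fun w => \sum_(1 <= t < T.+1) \sum_i dotv (D i t w) (decision r i t w - us t))
    (fun w => \sum_(1 <= t < T.+1) \sum_i dotv (g i t w) (decision r i t w - us t)).
  apply: same_mean_sum => t; rewrite mem_index_iota ltnS => tT.
  by apply: same_mean_sum => i _; exact: g_unbiased.
have [_ ig _] := same; apply: same_mean_le same _.
apply: le_mean_le ig sum_linearized_regret_le _.
apply: mean_leD (mean_le_cst _ _) _.
rewrite mulr_sumr; apply: mean_le_sum => t; rewrite mem_index_iota ltnS => tT.
have a0 := alpha0 tT.
(* Mirror descent gives [alpha t / (2 * rho)]; it is doubled to reach the stated constant. *)
apply: (@mean_leW _ _ _ _ _ (alpha t / (2 * rho) * \sum_(i < n) L ^+ 2)).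
  rewrite sumr_const card_ord -(mulr_natl (L ^+ 2)) -subr_ge0.
  have -> : n%:R * L ^+ 2 / rho * alpha t - alpha t / (2 * rho) * (n%:R * L ^+ 2) =
      alpha t * (n%:R * L ^+ 2) / (2 * rho) by field; rewrite lt0r_neq0.
  by rewrite divr_ge0 ?mulr_ge0 ?sqr_ge0 ?(ltW a0) ?(ltW rho0).
apply: mean_leZ; first by rewrite divr_ge0 ?mulr_ge0 ?(ltW a0) ?(ltW rho0).
by apply: mean_le_sum => i _; exact: g_sqr.
Qed.

End Means.
End Block.

(** * Stochastic oracles and the history *)

Section Oracle.
Context (dd : measure_display) (Om : measurableType dd) (R : realType).
Context (P : probability Om R) (G : set (set Om)).
Hypothesis G_set0 : G set0.
Hypothesis G_setT : G setT.

Lemma coord_events_cst (d : nat) (x : 'cV[R]_d) : coord_events (fun _ : Om => x) `<=` G.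
Proof.
move=> _ [k _ [S mS <-]]; have [Sx|Sx] := pselect (S (x k 0)).
  by rewrite (_ : _ `&` _ = setT)//; apply/seteqP; split.
by rewrite (_ : _ `&` _ = set0)//; apply/seteqP; split=> // w [_ /Sx].
Qed.

Lemma coord_events_ge (d : nat) (U : Om -> 'cV[R]_d) (c s : R) k :
  coord_events U `<=` G -> G [set w | s <= U w k 0 - c].
Proof.
move=> UG; apply: UG; exists k => //; exists `[s + c, +oo[%classic => //.
by apply/seteqP; split => w; rewrite /= in_itv/= andbT lerBrDr// => -[].
Qed.

Context (d m p : nat) (X : set 'cV[R]_d) (Y : set 'cV[R]_m) (N : 'cV[R]_p -> R).
Context (L : R) (o : 'cV[R]_d -> 'cV[R]_m -> Om -> 'cV[R]_p).
Context (D : 'cV[R]_d -> 'cV[R]_m -> 'cV[R]_p).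
Hypothesis hN : is_norm N.
Hypothesis L0 : 0 <= L.
Hypothesis o_unbiased : unbiased_oracle P G X Y N L o D.

Lemma oracle_second_moment (a : Om -> 'cV[R]_d) (b : Om -> 'cV[R]_m) :
  (forall w, X (a w)) -> (forall w, Y (b w)) ->
  coord_events a `<=` G -> coord_events b `<=` G ->
  mean_le P (fun w => dual_norm N (o (a w) (b w) w) ^+ 2) (L ^+ 2).
Proof.
move=> aX bY aG bG; have [_ [W ceW WL]] := o_unbiased aX bY aG bG.
have [iU iW eUW] := cond_exp_same_mean G_setT ceW.
split => //; rewrite eUW.
have mW : measurable_fun setT W by apply/measurable_EFinP; exact: measurable_int iW.
(* [W <= L ^+ 2] holds almost everywhere only, and the comparison used for that is for nonnegative
   functions: [W] is replaced by its positive part. *)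
pose W' w := Num.max (W w) 0.
apply: le_trans (_ : \int[P]_w (W' w)%:E <= _)%E.
  by apply: le_integral_nonmeasurable => w; rewrite lee_fin le_max lexx.
have [_] := mean_le_cst P (L ^+ 2); apply: le_trans.
apply: ae_ge0_le_integral => //.
- by move=> w _; rewrite lee_fin le_max lexx orbT.
- by apply/measurable_EFinP; apply: measurable_maxr.
- by move=> w _; rewrite lee_fin sqr_ge0.
- apply: filterS WL => w h _; rewrite lee_fin ge_max h; exact: sqr_ge0.
Qed.

(** Coordinate by coordinate, the components of [u - u0] are bounded factors measurable for [G],
    which can be pulled out of the conditional expectation. *)
Lemma oracle_same_mean (a : Om -> 'cV[R]_d) (b : Om -> 'cV[R]_m)
    (u : Om -> 'cV[R]_p) (u0 : 'cV[R]_p) (e : R) :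
  (forall w, X (a w)) -> (forall w, Y (b w)) ->
  coord_events a `<=` G -> coord_events b `<=` G -> coord_events u `<=` G ->
  random_vector u -> (forall w, N (u w - u0) <= e) ->
  same_mean P (fun w => dotv (D (a w) (b w)) (u w - u0))
              (fun w => dotv (o (a w) (b w) w) (u w - u0)).
Proof.
move=> aX bY aG bG uG mu ue; have [ce _] := o_unbiased aX bY aG bG.
have [C C0 hC] := coord_le_is_norm hN.
apply: same_mean_sum => k _.
have [i1 i2 e12] : same_mean P
    (fun w => o (a w) (b w) w k 0 * (u w - u0) k 0)
    (fun w => D (a w) (b w) k 0 * (u w - u0) k 0).
  apply: (@cond_exp_mul _ _ _ _ G G_setT _ _ _ (C * e) (ce k)).
  - under eq_fun do rewrite !mxE.
    by apply: measurable_funD => //; exact: mu.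
  - by move=> w; apply: le_trans (hC _ _) _; rewrite ler_wpM2l.
  - by move=> s; under eq_set do rewrite !mxE; exact: coord_events_ge.
by split.
Qed.

(* Jensen's inequality at a deterministic point, through
   |g| <= (|g|^2 / c + c) / 2 for every c > L. *)
Lemma oracle_dual_norm_le x y : X x -> Y y -> dual_norm N (D x y) <= L.
Proof.
move=> Xx Yy.
have sq := @oracle_second_moment (fun=> x) (fun=> y) (fun=> Xx) (fun=> Yy)
  (@coord_events_cst _ _) (@coord_events_cst _ _).
apply: (dual_norm_le hN) => u u1; apply/ler_addgt0Pr => e e0.
(* The margin [e] makes the divisor positive even when [L] is 0. *)
have c0 : 0 < L + e by rewrite ltr_wpDl.
have mu : random_vector (fun _ : Om => u) by move=> k; exact: measurable_cst.
have := @oracle_same_mean (fun=> x) (fun=> y) (fun=> u) 0 1 (fun=> Xx) (fun=> Yy)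
  (@coord_events_cst _ _) (@coord_events_cst _ _) (@coord_events_cst _ _) mu.
rewrite subr0 => /(_ (fun=> u1)) same.
have bound : mean_le P (fun w => dotv (o x y w) u)
    (2^-1 * ((L + e)^-1 * L ^+ 2 + (L + e))).
  have [_ ig _] := same; apply: le_mean_le ig _ _; last first.
    apply: mean_leZ; first by rewrite invr_ge0.
    apply: mean_leD (mean_le_cst _ _); apply: mean_leZ sq.
    by rewrite invr_ge0 ltW.
  move=> w; set q := dual_norm N (o x y w).
  have q0 : 0 <= q by exact: dual_norm_ge0.
  apply: le_trans (dotv_le_dual hN _ _) _; apply: le_trans (_ : q <= _).
    by rewrite ler_piMr.
  rewrite -subr_ge0.
  have -> : 2^-1 * ((L + e)^-1 * q ^+ 2 + (L + e)) - q = (q - (L + e)) ^+ 2 / (2 * (L + e)).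
    by field; rewrite lt0r_neq0.
  by rewrite divr_ge0 ?sqr_ge0// mulr_ge0// ltW.
have [_] := same_mean_le same bound.
rewrite integral_cst_probability lee_fin => h; apply: le_trans h _.
rewrite ler_pdivrMl//.
have : (L + e)^-1 * L ^+ 2 <= L + e by rewrite ler_pdivrMl// -expr2 lerXn2r ?nnegrE ?(ltW c0)// lerDl ltW.
lra.
Qed.

End Oracle.

Section History.
Context (dd : measure_display) (Om : measurableType dd) (R : realType).
Context (n d T : nat).

(** Ascent is descent with negated samples, so the results on one block serve for [y] too. *)
Lemma block_algorithm_opp (phi : 'cV[R]_d -> R) (X : set 'cV[R]_d) (eta : nat -> R)
    K E A B u1 (g : 'I_n -> nat -> Om -> 'cV[R]_d) r :
  block_algorithm T phi X (fun t => - eta t) K E A B u1 g r ->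
  block_algorithm T phi X eta K E A B u1 (fun i t w => - g i t w) r.
Proof.
case=> h1 h2 h3 h4 h5 h6 h7; split => // i t w tT.
by rewrite h3// scaleNr scalerN.
Qed.

(** The first decision is constant; a later one is the last consensus iterate of the round before,
    whose events lie in [H]. *)
Lemma decision_coord_events phi X step K E A B u1
    (g : 'I_n -> nat -> Om -> 'cV[R]_d) r (H : set (set Om)) i t :
  block_algorithm T phi X step K E A B u1 g r -> H set0 -> H setT ->
  (forall s, (1 <= s <= t)%N -> block_events K r g s `<=` H) -> (t <= T)%N ->
  coord_events (decision r i t.+1) `<=` H.
Proof.
move=> alg H0 HT sub tT; case: t => [|t] in sub tT *.
  rewrite (_ : decision r i 1 = fun=> u1 i); first exact: coord_events_cst.
  by apply/funext => w; rewrite (block_init alg).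
rewrite (_ : decision r i t.+2 = consensus r i t.+1 (K t.+1).+1); last first.
  by apply/funext => w; rewrite (block_next alg).
apply: subset_trans (sub t.+1 _); last by rewrite /= leqnn.
by move=> S hS; exists i => //; right; exists (K t.+1).+1 => //=; rewrite leqnn.
Qed.

End History.

Section HistorySigmaField.
Context (dd : measure_display) (Om : measurableType dd) (R : realType) (n d m : nat).
Context (K : nat -> nat).
Context (gx : 'I_n -> nat -> 'cV[R]_d -> 'cV[R]_m -> Om -> 'cV[R]_d).
Context (gy : 'I_n -> nat -> 'cV[R]_d -> 'cV[R]_m -> Om -> 'cV[R]_m).
Context (rx : block_run Om R n d) (ry : block_run Om R n m) (t : nat).

Lemma history_set0 : history K gx gy rx ry t set0.
Proof. exact: sigma_algebra0. Qed.

Lemma history_setT : history K gx gy rx ry t setT.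
Proof.
by have := sigma_algebraCD history_set0; rewrite setD0.
Qed.

Lemma history_block_events s : (1 <= s <= t)%N ->
  block_events K rx (oracle_output gx rx ry) s `<=` history K gx gy rx ry t /\
  block_events K ry (oracle_output gy rx ry) s `<=` history K gx gy rx ry t.
Proof.
move=> st; split=> S hS; apply: sub_sigma_algebra; exists s => //; by [left|right].
Qed.

End HistorySigmaField.

Lemma average_in (R : realType) (n d : nat) (X : set 'cV[R]_d) (u : 'I_n -> 'cV[R]_d) :
  (0 < n)%N -> convex_set X -> (forall i, X (u i)) -> X (average u).
Proof.
move=> n0 cX uX; rewrite /average scaler_sumr; apply: convex_set_sum => //.
by rewrite sumr_const card_ord -(mulr_natl n%:R^-1) mulfV// pnatr_eq0 -lt0n.
Qed.

(** * Assembling the two blocks *)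

Theorem theorem2 (R : realType) (dd : measure_display)
  (Om : measurableType dd) (P : probability Om R)
  (n d m T : nat)
  (* norms, decision sets, objective functions, saddle points *)
  (Nx : 'cV[R]_d -> R) (Ny : 'cV[R]_m -> R)
  (hNx : is_norm Nx) (hNy : is_norm Ny)
  (X : set 'cV[R]_d) (Y : set 'cV[R]_m)
  (hXconv : convex_set X) (hYconv : convex_set Y)
  (hXcomp : compact X) (hYcomp : compact Y)
  (MX MY : R) (hMX : 0 < MX) (hMY : 0 < MY)
  (hXdiam : forall x x', X x -> X x' -> Nx (x - x') <= MX)
  (hYdiam : forall y y', Y y -> Y y' -> Ny (y - y') <= MY)
  (f : 'I_n -> nat -> 'cV[R]_d -> 'cV[R]_m -> R)
  (hfconvex : forall i t y, (1 <= t)%N ->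
     convex_function setT (fun x => f i t x y))
  (hfconcave : forall i t x, (1 <= t)%N ->
     convex_function setT (fun y => - f i t x y))
  (hfdiff : forall i t x y, (1 <= t)%N -> X x -> Y y ->
     differentiable (fun u => f i t u y : R^o) x /\
     differentiable (fun v => f i t x v : R^o) y)
  (xs : nat -> 'cV[R]_d) (ys : nat -> 'cV[R]_m)
  (hsaddle : forall t, (1 <= t)%N ->
     saddle_point X Y (network_function f t) (xs t) (ys t))
  (* network *)
  (E : nat -> rel 'I_n) (A : nat -> 'M[R]_n) (zeta : R)
  (hzeta : 0 < zeta < 1)
  (hAstoch : forall t, (1 <= t <= T)%N -> doubly_stochastic (A t))
  (hAweight : forall t i j, (1 <= t <= T)%N ->
     (j \in in_nbhd (E t) i -> zeta < A t i j) /\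
     (j \notin in_nbhd (E t) i -> A t i j = 0))
  (* Bregman divergences *)
  (Rx : 'cV[R]_d -> R) (Ry : 'cV[R]_m -> R)
  (hRxdiff : forall x, differentiable (Rx : 'cV[R]_d -> R^o) x)
  (hRydiff : forall y, differentiable (Ry : 'cV[R]_m -> R^o) y)
  (rhox rhoy : R) (hrhox : 0 < rhox) (hrhoy : 0 < rhoy)
  (hRxconv : strongly_convex_on Nx rhox X Rx)
  (hRyconv : strongly_convex_on Ny rhoy Y Ry)
  (* algorithm *)
  (alpha eta : nat -> R) (K : nat -> nat)
  (B : nat -> 'M[R]_d) (C : nat -> 'M[R]_m)
  (x1 : 'I_n -> 'cV[R]_d) (y1 : 'I_n -> 'cV[R]_m)
  (hx1 : forall i, X (x1 i)) (hy1 : forall i, Y (y1 i))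
  (halpha : forall t, (1 <= t <= T)%N -> 0 < alpha t)
  (heta : forall t, (1 <= t <= T)%N -> 0 < eta t)
  (halpha_noninc : forall t, (1 <= t < T)%N -> alpha t.+1 <= alpha t)
  (heta_noninc : forall t, (1 <= t < T)%N -> eta t.+1 <= eta t)
  (hK : forall t, (1 <= t <= T)%N -> (0 < K t)%N)
  (gx : 'I_n -> nat -> 'cV[R]_d -> 'cV[R]_m -> Om -> 'cV[R]_d)
  (gy : 'I_n -> nat -> 'cV[R]_d -> 'cV[R]_m -> Om -> 'cV[R]_m)
  (hindep : forall i t, (1 <= t <= T)%N ->
     independent_systems P (oracle_sigma X Y (gx i t))
                           (oracle_sigma X Y (gy i t)))
  (rx : block_run Om R n d) (ry : block_run Om R n m)
  (halgx : block_algorithm T Rx X alpha K E A B x1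
             (oracle_output gx rx ry) rx)
  (halgy : block_algorithm T Ry Y (fun t => - eta t) K E A C y1
             (oracle_output gy rx ry) ry)
  (* Assumption 2 *)
  (LX LY : R) (hLX : 0 <= LX) (hLY : 0 <= LY)
  (hA2x : forall i t, (1 <= t <= T)%N ->
     unbiased_oracle P (history K gx gy rx ry t.-1) X Y Nx LX (gx i t)
       (fun x y => grad (fun u => f i t u y) x))
  (hA2y : forall i t, (1 <= t <= T)%N ->
     unbiased_oracle P (history K gx gy rx ry t.-1) X Y Ny LY (gy i t)
       (fun x y => grad (fun v => f i t x v) y))
  (* Assumption 3 *)
  (KX KY : R)
  (hA3x : forall a b c, X a -> X b -> X c ->
     `|bregman Rx a c - bregman Rx b c| <= KX * Nx (a - b))
  (hA3y : forall a b c, Y a -> Y b -> Y c ->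
     `|bregman Ry a c - bregman Ry b c| <= KY * Ny (a - b))
  (hA3sx : forall (s : 'I_n -> R) x (z : 'I_n -> 'cV[R]_d), simplex s ->
     bregman Rx x (\sum_i s i *: z i) <= \sum_i s i * bregman Rx x (z i))
  (hA3sy : forall (s : 'I_n -> R) y (v : 'I_n -> 'cV[R]_m), simplex s ->
     bregman Ry y (\sum_i s i *: v i) <= \sum_i s i * bregman Ry y (v i))
  (* Assumption 4 *)
  (hA4x : forall t a b, (1 <= t <= T)%N -> X a -> X b ->
     bregman Rx (B t *m a) (B t *m b) <= bregman Rx a b)
  (hA4y : forall t a b, (1 <= t <= T)%N -> Y a -> Y b ->
     bregman Ry (C t *m a) (C t *m b) <= bregman Ry a b)
  (hA4B : forall t, (1 <= t <= T)%N -> op_norm Nx (B t) <= 1)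
  (hA4C : forall t, (1 <= t <= T)%N -> op_norm Ny (C t) <= 1)
  (hA4X : forall t x, (1 <= t <= T)%N -> X x -> X (B t *m x))
  (hA4Y : forall t y, (1 <= t <= T)%N -> Y y -> Y (C t *m y))
  (* Assumption 5 *)
  (hA5 : forall t, (1 <= t <= T)%N -> strongly_connected (E t))
  (hT : (2 <= T)%N) (j : 'I_n) :
  let Kmin := \big[minn/K 1%N]_(1 <= t < T.+1) K t in
  let Gamma1 := (1 - zeta / (4 * n%:R ^+ 2))^-1 in
  let sigma1 := 1 - zeta / (4 * n%:R ^+ 2) in
  let c := Gamma1 * sigma1 ^+ (Kmin - 1)%N / (1 - sigma1 ^+ Kmin) in
  let Xi :=
    n%:R * KX * \sum_(1 <= t < T.+1)
                   (alpha t)^-1 * Nx (xs t.+1 - B t *m xs t) +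
    n%:R * KY * \sum_(1 <= t < T.+1)
                   (eta t)^-1 * Ny (ys t.+1 - C t *m ys t) in
  let I1 := (n%:R + 2) *
    \sum_i (LX * Nx (x1 i - average x1) + LY * Ny (y1 i - average y1)) in
  let I2 := n%:R * (n%:R + 2) * \sum_i (LX * Nx (x1 i) + LY * Ny (y1 i)) in
  let I3 := n%:R * LX ^+ 2 / rhox in
  let I4 := n%:R ^+ 2 * (n%:R + 2) * LX ^+ 2 / rhox in
  let I5 := n%:R * LY ^+ 2 / rhoy in
  let I6 := n%:R ^+ 2 * (n%:R + 2) * LY ^+ 2 / rhoy in
  let RX := bregman_diameter Rx X in
  let RY := bregman_diameter Ry Y in
  (esp_regret P f rx ry xs ys T j <=
    (I1 + c * I2 +
     (I3 + c * I4) * (\sum_(1 <= t < T.+1) alpha t) +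
     (I5 + c * I6) * (\sum_(1 <= t < T.+1) eta t) +
     n%:R * RX / alpha T + n%:R * RY / eta T + Xi)%:E)%E.
Proof.
cbv zeta.
have n0 : (0 < n)%N by exact: leq_ltn_trans (ltn_ord j).
have T0 : (0 < T)%N by exact: leq_trans hT.
have halgy' := block_algorithm_opp halgy.
have dXin i t w : (1 <= t <= T.+1)%N -> X (decision rx i t w).
  exact: (decision_in hXconv hAstoch hAweight hx1 halgx hA4X).
have dYin i t w : (1 <= t <= T.+1)%N -> Y (decision ry i t w).
  exact: (decision_in hYconv hAstoch hAweight hy1 halgy' hA4Y).
have tS t : (1 <= t <= T)%N -> (1 <= t <= T.+1)%N.
  by case/andP=> -> /leqW.
have H0 t : history K gx gy rx ry t set0 by exact: history_set0.
have HT t : history K gx gy rx ry t setT by exact: history_setT.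
have evx i t : (1 <= t <= T)%N ->
    coord_events (decision rx i t) `<=` history K gx gy rx ry t.-1.
  case: t => // t /andP[_ tT].
  apply: (decision_coord_events halgx (H0 t) (HT t) _ (ltnW tT)).
  by move=> s /(history_block_events K gx gy rx ry)[].
have evy i t : (1 <= t <= T)%N ->
    coord_events (decision ry i t) `<=` history K gx gy rx ry t.-1.
  case: t => // t /andP[_ tT].
  apply: (decision_coord_events halgy (H0 t) (HT t) _ (ltnW tT)).
  by move=> s /(history_block_events K gx gy rx ry)[].
(* The second moments of the samples bound the true gradients, hence the Lipschitz constants of [f]
   on [X] and [Y]. *)
have gradx i t x y : (1 <= t <= T)%N -> X x -> Y y ->
    dual_norm Nx (grad (fun u => f i t u y) x) <= LX.
  move=> tT Xx Yy.
  exact: (oracle_dual_norm_le (H0 t.-1) (HT t.-1) hNx hLX (hA2x i t tT) Xx Yy).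
have grady i t x y : (1 <= t <= T)%N -> X x -> Y y ->
    dual_norm Ny (grad (fun v => f i t x v) y) <= LY.
  move=> tT Xx Yy.
  exact: (oracle_dual_norm_le (H0 t.-1) (HT t.-1) hNy hLY (hA2y i t tT) Xx Yy).
have lipx i t u u' v : (1 <= t <= T)%N -> X u -> X u' -> Y v ->
    f i t u v - f i t u' v <= LX * Nx (u - u').
  move=> tT Xu Xu' Yv; have [t1 _] := andP tT.
  have [df _] := hfdiff i t _ _ t1 Xu Yv.
  have := convex_first_order u' (hfconvex i t v t1) df.
  rewrite -(opprB u u') dotvNr => h.
  apply: le_trans (_ : dotv (grad (fun x => f i t x v) u) (u - u') <= _); first by lra.
  apply: le_trans (dotv_le_dual hNx _ _) _.
  by rewrite ler_wpM2r ?is_norm_ge0// gradx.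
have lipy i t u v v' : (1 <= t <= T)%N -> X u -> Y v -> Y v' ->
    f i t u v - f i t u v' <= LY * Ny (v - v').
  move=> tT Xu Yv Yv'; have [t1 _] := andP tT.
  have [_ df] := hfdiff i t _ _ t1 Xu Yv'.
  apply: le_trans (concave_first_order v (hfconcave i t u t1) df) _.
  apply: le_trans (dotv_le_dual hNy _ _) _.
  by rewrite ler_wpM2r ?is_norm_ge0// grady.
have xsX t : (1 <= t)%N -> X (xs t) by move=> /hsaddle[].
have ysY t : (1 <= t)%N -> Y (ys t) by move=> /hsaddle[].
pose Dx i t w := grad (fun u => f i t u (decision ry i t w)) (decision rx i t w).
(* The [y]-block is treated as descent on [- f], hence the sign. *)
pose Dy i t w := - grad (fun v => f i t (decision rx i t w) v) (decision ry i t w).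
have sqx i t : (1 <= t <= T)%N ->
    mean_le P (fun w => dual_norm Nx (oracle_output gx rx ry i t w) ^+ 2) (LX ^+ 2).
  move=> tT; apply: (oracle_second_moment (HT t.-1) (hA2x i t tT) _ _ (evx i t tT) (evy i t tT)).
    by move=> w; exact/dXin/tS.
  by move=> w; exact/dYin/tS.
have sqy i t : (1 <= t <= T)%N ->
    mean_le P (fun w => dual_norm Ny (- oracle_output gy rx ry i t w) ^+ 2) (LY ^+ 2).
  move=> tT; under eq_fun do rewrite (dual_normN hNy).
  apply: (oracle_second_moment (HT t.-1) (hA2y i t tT) _ _ (evx i t tT) (evy i t tT)).
    by move=> w; exact/dXin/tS.
  by move=> w; exact/dYin/tS.
have unx i t : (1 <= t <= T)%N ->
    same_mean P (fun w => dotv (Dx i t w) (decision rx i t w - xs t))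
      (fun w => dotv (oracle_output gx rx ry i t w) (decision rx i t w - xs t)).
  move=> tT; have [t1 _] := andP tT; have [mx _ _ _] := block_random halgx i tT.
  apply: (oracle_same_mean (HT t.-1) hNx (hA2x i t tT) _ _ (evx i t tT) (evy i t tT)
    (evx i t tT) mx (e := MX)) => w; try exact/dXin/tS; try exact/dYin/tS.
  by apply: hXdiam; [exact/dXin/tS|exact: xsX].
have uny i t : (1 <= t <= T)%N ->
    same_mean P (fun w => dotv (Dy i t w) (decision ry i t w - ys t))
      (fun w => dotv (- oracle_output gy rx ry i t w) (decision ry i t w - ys t)).
  move=> tT; have [t1 _] := andP tT; have [my _ _ _] := block_random halgy i tT.
  under eq_fun do rewrite dotvNl -mulN1r.
  under [X in same_mean _ _ X]eq_fun do rewrite dotvNl -mulN1r.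
  apply: same_meanZ.
  apply: (oracle_same_mean (HT t.-1) hNy (hA2y i t tT) _ _ (evx i t tT) (evy i t tT)
    (evy i t tT) my (e := MY)) => w; try exact/dXin/tS; try exact/dYin/tS.
  by apply: hYdiam; [exact/dYin/tS|exact: ysY].
have [Vx devx meanVx] := network_error_mean hNx n0 T0 hXconv hzeta hAstoch hAweight
  hA5 hRxdiff hrhox hRxconv hx1 halpha hK halgx hA4B hA4X hLX sqx.
have [Vy devy meanVy] := network_error_mean hNy n0 T0 hYconv hzeta hAstoch hAweight
  hA5 hRydiff hrhoy hRyconv hy1 heta hK halgy' hA4C hA4Y hLY sqy.
have regx := linearized_regret_mean hNx T0 hXconv hXdiam hAstoch hAweight
  hRxdiff hrhox hRxconv hx1 halpha halpha_noninc halgx hA3x hA3sx hA4x hA4X xsX hLX sqx unx.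
have regy := linearized_regret_mean hNy T0 hYconv hYdiam hAstoch hAweight
  hRydiff hrhoy hRyconv hy1 heta heta_noninc halgy' hA3y hA3sy hA4y hA4Y ysY hLY sqy uny.
rewrite /esp_regret.
have split_sum w : \sum_(1 <= t < T.+1) \sum_i
      (LX * Nx (decision rx i t w - average (fun j => decision rx j t w)) +
       LY * Ny (decision ry i t w - average (fun j => decision ry j t w))) <=
    Vx w + Vy w.
  apply: le_trans (lerD (devx w) (devy w)).
  rewrite !mulr_sumr -big_split/=; apply: ler_sum => t _.
  by rewrite !mulr_sumr -big_split.
have avgX t w : (1 <= t <= T)%N -> X (average (fun j => decision rx j t w)).
  by move=> tT; apply: average_in => // i; exact/dXin/tS.
have avgY t w : (1 <= t <= T)%N -> Y (average (fun j => decision ry j t w)).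
  by move=> tT; apply: average_in => // i; exact/dYin/tS.
have upper w : \sum_(1 <= t < T.+1)
      network_function f t (decision rx j t w) (decision ry j t w) -
    \sum_(1 <= t < T.+1) network_function f t (xs t) (ys t) <=
    (n%:R + 2) * (Vx w + Vy w) +
    \sum_(1 <= t < T.+1) \sum_i dotv (Dx i t w) (decision rx i t w - xs t).
  have n2 : 0 <= n%:R + 2 :> R by rewrite addr_ge0.
  apply: le_trans (lerD (ler_wpM2l n2 (split_sum w)) (lexx _)).
  rewrite mulr_sumr -big_split/= -sumrB; apply: ler_sum_nat => t; rewrite ltnS => tT; have [t1 _] := andP tT.
  apply: (@saddle_gap_le R n d m Nx Ny X Y LX LY (fun i => f i t)
    (fun i => decision rx i t w) (fun i => decision ry i t w)
    (average (fun i => decision rx i t w)) (xs t)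
    (average (fun i => decision ry i t w)) (ys t)
    (fun i => dotv (Dx i t w) (decision rx i t w - xs t))) => //.
  - by move=> i u u' v; exact: lipx.
  - by move=> i u v v'; exact: lipy.
  - by move=> i; exact/dXin/tS.
  - by move=> i; exact/dYin/tS.
  - exact: avgX.
  - exact: avgY.
  - exact: xsX.
  - by have [_ _ h _] := hsaddle t t1; apply: h; exact: avgY.
  - move=> i; have [dX dY] := (dXin i t w (tS t tT), dYin i t w (tS t tT)).
    have [df _] := hfdiff i t _ _ t1 dX dY.
    have := convex_first_order (xs t) (hfconvex i t (decision ry i t w) t1) df.
    rewrite -(opprB (decision rx i t w)) dotvNr; lra.
have lower w : - (\sum_(1 <= t < T.+1)
      network_function f t (decision rx j t w) (decision ry j t w) -
    \sum_(1 <= t < T.+1) network_function f t (xs t) (ys t)) <=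
    (n%:R + 2) * (Vx w + Vy w) +
    \sum_(1 <= t < T.+1) \sum_i dotv (Dy i t w) (decision ry i t w - ys t).
  have n2 : 0 <= n%:R + 2 :> R by rewrite addr_ge0.
  apply: le_trans (lerD (ler_wpM2l n2 (split_sum w)) (lexx _)).
  rewrite mulr_sumr -big_split/= -sumrB -sumrN; apply: ler_sum_nat => t; rewrite ltnS => tT; have [t1 _] := andP tT.
  have gap : \sum_i (- f i t (decision rx j t w) (decision ry j t w)) -
      \sum_i (- f i t (xs t) (ys t)) <= (n%:R + 2) *
      (\sum_i (LY * Ny (decision ry i t w - average (fun j => decision ry j t w)) +
               LX * Nx (decision rx i t w - average (fun j => decision rx j t w)))) +
      \sum_i dotv (Dy i t w) (decision ry i t w - ys t).
    (* The players exchange their roles: [- f] is convex in [y], and the other half of the saddle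
       inequality is used, at the average of the [x]-decisions. *)
    apply: (@saddle_gap_le R n m d Ny Nx Y X LY LX (fun i v u => - f i t u v)
      (fun i => decision ry i t w) (fun i => decision rx i t w)
      (average (fun i => decision ry i t w)) (ys t)
      (average (fun i => decision rx i t w)) (xs t)
      (fun i => dotv (Dy i t w) (decision ry i t w - ys t))) => //.
    - move=> i v v' u Yv Yv' Xu; rewrite opprK addrC (is_norm_distC hNy).
      exact: lipy.
    - move=> i v u u' Yv Xu Xu'; rewrite opprK addrC (is_norm_distC hNx).
      exact: lipx.
    - by move=> i; exact/dYin/tS.
    - by move=> i; exact/dXin/tS.
    - exact: avgY.
    - exact: avgX.
    - exact: ysY.
    - rewrite !sumrN lerN2.
      by have [_ _ _ h] := hsaddle t t1; apply: h; exact: avgX.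
    - move=> i; have [dX dY] := (dXin i t w (tS t tT), dYin i t w (tS t tT)).
      have [_ df] := hfdiff i t _ _ t1 dX dY.
      have := concave_first_order (ys t) (hfconcave i t (decision rx i t w) t1) df.
      rewrite /Dy dotvNl -(opprB (decision ry i t w)) dotvNr; lra.
  rewrite !sumrN opprK in gap; rewrite opprB [leLHS]addrC; apply: le_trans gap _.
  rewrite lerD2r ler_wpM2l//; apply: ler_sum => i _.
  by rewrite addrC.
have n2 : 0 <= n%:R + 2 :> R by rewrite addr_ge0.
have etaT : 0 < eta T by apply: heta; rewrite T0 leqnn.
have alphaT : 0 < alpha T by apply: halpha; rewrite T0 leqnn.
(* Each one-sided estimate has the mirror descent terms of one block only; those of the other block
   are added, so they must be nonnegative. *)
have RX0 : 0 <= n%:R * bregman_diameter Rx X / alpha T.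
  rewrite divr_ge0 ?(ltW alphaT)// mulr_ge0//.
  apply: le_trans (bregman_diameter_ge hNx hXdiam hA3x (xsX 1%N isT) (xsX 1%N isT)).
  by rewrite bregman_refl.
have RY0 : 0 <= n%:R * bregman_diameter Ry Y / eta T.
  rewrite divr_ge0 ?(ltW etaT)// mulr_ge0//.
  apply: le_trans (bregman_diameter_ge hNy hYdiam hA3y (ysY 1%N isT) (ysY 1%N isT)).
  by rewrite bregman_refl.
have XiX0 : 0 <= n%:R * KX * (\sum_(1 <= t < T.+1)
    (alpha t)^-1 * Nx (xs t.+1 - B t *m xs t)).
  rewrite mulr_sumr big_nat_cond; apply: sumr_ge0 => t.
  rewrite andbT ltnS => tT; have [t1 _] := andP tT.
  rewrite mulrACA; apply: mulr_ge0; first by rewrite mulr_ge0// invr_ge0 (ltW (halpha t tT)).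
  (* [KX * Nx] of the drift is nonnegative because it dominates an absolute value; the sign of [KX]
     itself is not given. *)
  apply: le_trans (hA3x _ _ _ (xsX t.+1 isT) (hA4X t _ tT (xsX t t1)) (xsX 1%N isT)).
  exact: normr_ge0.
have XiY0 : 0 <= n%:R * KY * (\sum_(1 <= t < T.+1)
    (eta t)^-1 * Ny (ys t.+1 - C t *m ys t)).
  rewrite mulr_sumr big_nat_cond; apply: sumr_ge0 => t.
  rewrite andbT ltnS => tT; have [t1 _] := andP tT.
  rewrite mulrACA; apply: mulr_ge0; first by rewrite mulr_ge0// invr_ge0 (ltW (heta t tT)).
  apply: le_trans (hA3y _ _ _ (ysY t.+1 isT) (hA4Y t _ tT (ysY t t1)) (ysY 1%N isT)).
  exact: normr_ge0.
have Salpha : 0 <= n%:R * LX ^+ 2 / rhox * (\sum_(1 <= t < T.+1) alpha t).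
  rewrite mulr_ge0// ?divr_ge0 ?mulr_ge0 ?sqr_ge0 ?(ltW hrhox)// big_nat_cond.
  by apply: sumr_ge0 => t; rewrite andbT ltnS => /halpha/ltW.
have Seta : 0 <= n%:R * LY ^+ 2 / rhoy * (\sum_(1 <= t < T.+1) eta t).
  rewrite mulr_ge0// ?divr_ge0 ?mulr_ge0 ?sqr_ge0 ?(ltW hrhoy)// big_nat_cond.
  by apply: sumr_ge0 => t; rewrite andbT ltnS => /heta/ltW.
apply: (expectation_abs_le upper _ lower _).
  apply: mean_leW (mean_leD (mean_leZ n2 (mean_leD meanVx meanVy)) regx).
  rewrite !big_split/= -!mulr_sumr.
  lra.
apply: mean_leW (mean_leD (mean_leZ n2 (mean_leD meanVx meanVy)) regy).
rewrite !big_split/= -!mulr_sumr.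
lra.
Qed.
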